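(* The geometric thickness of the complete graph $K_{15}$ is $\overline{\theta}(K_{15}) = 4$.
   Context: The geometric thickness $\overline{\theta}(G)$ of a graph $G$ is the smallest integer $k$ such that there is an injective placement of the vertices of $G$ at points of the plane, with each edge drawn as the straight line segment between the points of its endpoints and containing no other vertex point, together with an assignment of each edge to one of $k$ layers, such that no two edges assigned to the same layer cross (i.e., two edges in the same layer meet at most in a common endpoint). *)

(* Defs.v *)
From HB Require Import structures.
From mathcomp Require Import all_boot all_order all_algebra.
From mathcomp Require Import Rstruct.
Set Implicit Arguments. Unset Strict Implicit. Unset Printing Implicit Defensive.
Import Order.TTheory GRing.Theory Num.Theory.
Local Open Scope ring_scope.

Section GeomThickness.
Variable R : realFieldType.

Definition point := (R * R)%type.

Definition on_seg (p q z : point) : Prop :=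
  exists2 t : R, 0 <= t <= 1 &
    z = ((1 - t) * p.1 + t * q.1, (1 - t) * p.2 + t * q.2).

Variable V : finType.

(* A (simple) graph on V is given by its adjacency relation [adj], assumed
   symmetric and irreflexive where used; {u,v} is an edge iff adj u v. *)

Definition same_edge (u v x y : V) : Prop :=
  (x = u /\ y = v) \/ (x = v /\ y = u).

Definition geometric_drawing (adj : rel V) (k : nat)
    (pos : V -> point) (layer : V -> V -> 'I_k) : Prop :=
  [/\ injective pos,
      (forall u v, adj u v -> layer u v = layer v u),
      (forall u v w, adj u v -> w <> u -> w <> v -> ~ on_seg (pos u) (pos v) (pos w))
    & (forall u v x y, adj u v -> adj x y -> ~ same_edge u v x y ->
         layer u v = layer x y ->
         forall z : point, on_seg (pos u) (pos v) z -> on_seg (pos x) (pos y) z ->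
           exists2 w : V, (w = u \/ w = v) /\ (w = x \/ w = y) & z = pos w)].

Definition geom_drawable (adj : rel V) (k : nat) : Prop :=
  exists (pos : V -> point) (layer : V -> V -> 'I_k), geometric_drawing adj pos layer.

Definition geometric_thickness_eq (adj : rel V) (k : nat) : Prop :=
  geom_drawable adj k /\ (forall j, geom_drawable adj j -> (k <= j)%N).

End GeomThickness.

Definition complete_graph (n : nat) : rel 'I_n := fun i j => i != j.
Arguments complete_graph n : clear implicits.

(* Main.v *)
From Stdlib Require Import ZArith.
Require Import Defs.
From mathcomp Require Import all_boot all_order all_algebra.
From mathcomp Require Import Rstruct.
From mathcomp Require Import ring lra zify ssrZ.
Set Implicit Arguments. Unset Strict Implicit. Unset Printing Implicit Defensive.

(** Lower bound. In general position a maximal plane set of segments on [n]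
points, [h] of them on the convex hull, has at most [3n - 3 - h] elements, so
three maximal layers contain at most [126 - 3h] segments of 15 points, counted
with multiplicity. All 105 segments are covered and a segment that no other
one crosses is counted three times; all hull edges are of this kind, hence
[105 + 2h <= 126 - 3h] and [h <= 4]. If [h = 4], one of the four ears (triangles
of three consecutive hull vertices [c], [a], [b]) contains a point; with [x] the
neighbour of [b] on the hull of the points other than [a], the segment [a x] is
uncrossed as well, and the count fails. If [h = 3], each hull vertex has such a
segment. Moreover let [y] play the role of [x] once [x] is removed too: only
segments from [x] can cross [a y], only segments from [a] can cross [x y], and
any two such segments cross each other, so every maximal layer contains [a y]
or [x y] and one of these two is counted at least twice. This gives
[105 + 2 * 6 + 1 > 126 - 9].

Upper bound. An outer ring of 8 points and a much smaller inner ring of 7, placed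
off the centre. A layer consists of a zigzag of the inner ring, of all segments
from inner points to two opposite outer points, and of the zigzag of the outer
ring through these two points. *)

(** * Distinctness of short lists *)

Section Uniq.
Variable T : eqType.
Implicit Types a b c d e : T.

Lemma uniq3E a b c : uniq [:: a; b; c] = [&& a != b, a != c & b != c].
Proof. by rewrite /= !inE !negb_or !andbT -!andbA. Qed.

Lemma uniq4E a b c d : uniq [:: a; b; c; d] =
  [&& a != b, a != c, a != d, b != c, b != d & c != d].
Proof. by rewrite /= !inE !negb_or !andbT -!andbA. Qed.

Lemma uniq5E a b c d e : uniq [:: a; b; c; d; e] =
  [&& a != b, a != c, a != d, a != e, b != c, b != d, b != e, c != d, c != e & d != e].
Proof. by rewrite /= !inE !negb_or !andbT -!andbA. Qed.
End Uniq.

Ltac uniqs := rewrite ?uniq3E ?uniq4E ?uniq5E; repeat (apply/andP; split);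
  first [assumption | by rewrite eq_sym].
Ltac duniq U := move: (U); rewrite ?uniq3E ?uniq4E ?uniq5E;
  repeat (let N := fresh "ne" in move=> /andP[N]); let N := fresh "ne" in move=> N.

(** * Order types and their decision procedure *)

Section Tables.
Variable T : Type.
(** Tables instead of functions: relations that agree on a list have equal tables there, so a
    predicate reading tables can be transported without being shown extensional. *)
Definition tab2 (r : T -> T -> bool) (s : seq T) : seq (seq bool) :=
  [seq [seq r x y | y <- s] | x <- s].
Definition tab3 (o : T -> T -> T -> bool) (s : seq T) : seq (seq (seq bool)) :=
  [seq [seq [seq o x y z | z <- s] | y <- s] | x <- s].
End Tables.

Definition get2 (t : seq (seq bool)) i j := nth false (nth [::] t i) j.
Definition get3 (t : seq (seq (seq bool))) i j k := nth false (nth [::] (nth [::] t i) j) k.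

(* No two changes of sign: the signotope axiom on the four triples of [a < b < c < d]. *)
Definition mono4 (a b c d : bool) : bool :=
  ((a ==> b) && (b ==> c) && (c ==> d)) || ((d ==> c) && (c ==> b) && (b ==> a)).

Definition triples (n : nat) : seq (nat * nat * nat) :=
  [seq (i, p.1, p.2) | i <- iota 0 n,
     p <- [seq (j, k) | j <- iota i.+1 (n - i.+1), k <- iota j.+1 (n - j.+1)]].

Definition sgn3 n (x : seq bool) i j k : bool := nth false x (index (i, j, k) (triples n)).

(* Extends the sign of increasing triples to all triples by antisymmetry. *)
Definition alt3 (c : nat -> nat -> nat -> bool) i j k : bool :=
  if i < j then
    if j < k then c i j k else if k < i then c k i j else (i < k) && (k < j) && ~~ c i k j
  else if j < i then
    if i < k then ~~ c j i k else if k < j then ~~ c k j i else (j < k) && (k < i) && c j k i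
  else false.

Definition signotope n (c : nat -> nat -> nat -> bool) : bool :=
  all (fun t => all (fun l => mono4 (c t.1.1 t.1.2 t.2) (c t.1.1 t.1.2 l) (c t.1.1 t.2 l) (c t.1.2 t.2 l))
    (iota t.2.+1 (n - t.2.+1))) (triples n).

Fixpoint bitseqs n : seq bitseq :=
  if n is m.+1 then map (cons true) (bitseqs m) ++ map (cons false) (bitseqs m) else [:: [::]].

Lemma mem_bitseqs (x : bitseq) : x \in bitseqs (size x).
Proof.
elim: x => //= b x IH; rewrite mem_cat.
by case: b; apply/orP; [left|right]; apply/mapP; exists x.
Qed.

Definition signotopes n : seq bitseq :=
  [seq x <- bitseqs (size (triples n)) | signotope n (sgn3 n x)].

(** [s] gives the ranks of the named points in the sweep order. The sign tables [X] do not depend on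
    [s] and are bound outside the loop, so evaluation builds them once. *)
Definition holds_on_signotopes n (g : (nat -> nat -> bool) -> bool)
    (f : (nat -> nat -> bool) -> (nat -> nat -> nat -> bool) -> bool) : bool :=
  let X := [seq get3 (tab3 (alt3 (sgn3 n x)) (iota 0 n)) | x <- signotopes n] in
  all (fun s => let l := get2 (tab2 ltn s) in
     g l ==> all (fun c => f l (get3 (tab3 c s))) X)
   (permutations (iota 0 n)).

(* [lt] is a sweep order (lexicographic for points of the plane) and [o u v w]
   means that the triangle [u v w] is oriented counterclockwise. *)
Record order_type (V : finType) (lt : rel V) (o : V -> V -> V -> bool) : Prop := OrderType {
  ot_irr : irreflexive lt;
  ot_trans : transitive lt;
  ot_total : forall u v, u != v -> lt u v || lt v u;
  ot_uniq : forall u v w, o u v w -> uniq [:: u; v; w];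
  ot_cyc : forall u v w, o u v w = o v w u;
  ot_anti : forall u v w, uniq [:: u; v; w] -> o v u w = ~~ o u v w;
  ot_mono : forall a b c d, lt a b -> lt b c -> lt c d ->
     mono4 (o a b c) (o a b d) (o a c d) (o b c d) }.

Section OT.
Variables (V : finType) (lt : rel V) (o : V -> V -> V -> bool).
Hypothesis ot : order_type lt o.

Lemma mem_triples n i j k : ((i, j, k) \in triples n) = [&& i < j, j < k & k < n].
Proof.
apply/idP/idP.
  move=> /allpairsPdep[a [[b c] [/= H /allpairsPdep[b' [c' [/= H1 H2 [-> ->]]]] [-> -> ->]]]].
  by move: H H1 H2; rewrite !mem_iota; lia.
move=> /and3P[ij jk kn].
apply/allpairsPdep; exists i, (j, k); split => //; first by rewrite mem_iota; lia.
by apply/allpairsPdep; exists j, k; split => //; rewrite mem_iota; lia.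
Qed.

Section Rank.
Variables (s : seq V) (x0 : V).
Hypothesis s_uniq : uniq s.

Let le x y := (x == y) || lt x y.
Let t := sort le s.
Let rk x := index x t.

Let le_total : total le.
Proof. by move=> x y; rewrite /le; case: eqVneq => //= /(ot_total ot)/orP[] ->; rewrite ?orbT. Qed.

Let le_trans : transitive le.
Proof.
move=> y x z /orP[/eqP->//|xy] /orP[/eqP<-|yz]; first by rewrite /le xy orbT.
by rewrite /le (ot_trans ot xy yz) orbT.
Qed.

Let t_uniq : uniq t. Proof. by rewrite sort_uniq. Qed.
Let mem_t x : (x \in t) = (x \in s). Proof. by rewrite mem_sort. Qed.

Let ot_asym x y : lt x y -> lt y x = false.
Proof. by move=> xy; apply/negP => /(ot_trans ot xy); rewrite (ot_irr ot). Qed.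

Let rk_lt x y : x \in s -> y \in s -> (rk x < rk y) = lt x y.
Proof.
move=> xs ys; case: (eqVneq x y) => [->|xy]; first by rewrite ltnn (ot_irr ot).
have H a b : a \in s -> b \in s -> rk a < rk b -> a != b -> lt a b.
  move=> sa sb ab nab.
  have := sorted_ltn_index le_trans (sort_sorted le_total s) a b.
  by rewrite -/t !mem_t /le => /(_ sa sb ab); rewrite (negPf nab).
apply/idP/idP => [/H -> //|L].
case: ltngtP => // [/H|E]; first by rewrite eq_sym (ot_asym L) => ->.
by move: xy; rewrite -(nth_index x0 (_ : x \in t)) ?mem_t// -/(rk x) E nth_index ?eqxx ?mem_t.
Qed.

Let sg := [seq o (nth x0 t p.1.1) (nth x0 t p.1.2) (nth x0 t p.2) | p <- triples (size s)].

Let sgE i j k : [&& i < j, j < k & k < size s] ->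
  sgn3 (size s) sg i j k = o (nth x0 t i) (nth x0 t j) (nth x0 t k).
Proof. by rewrite -mem_triples => H; rewrite /sgn3 (nth_map (0, 0, 0)) ?index_mem// nth_index. Qed.

Let t_lt i j : i < j -> j < size s -> lt (nth x0 t i) (nth x0 t j).
Proof.
move=> ij js; have is_ : i < size s by lia.
by rewrite -rk_lt -?mem_t ?mem_nth ?size_sort// /rk !index_uniq ?size_sort.
Qed.

Let sg_signotope : signotope (size s) (sgn3 (size s) sg).
Proof.
apply/allP => -[[i j] k]; rewrite mem_triples => /and3P[ij jk ks]; apply/allP => l /=.
rewrite mem_iota => H; rewrite !sgE; try lia.
by apply: (ot_mono ot); apply: t_lt; lia.
Qed.

(** By [ot_cyc] and [ot_anti] the six orders of three distinct points reduce to the increasing one;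
    on a repetition both sides are false. *)
Let altE x y z : x \in s -> y \in s -> z \in s ->
  alt3 (sgn3 (size s) sg) (rk x) (rk y) (rk z) = o x y z.
Proof.
move=> xs ys zs.
have rs a : a \in s -> rk a < size s by rewrite -(size_sort le s) index_mem mem_t.
have nr a : a \in s -> nth x0 t (rk a) = a by move=> sa; rewrite nth_index ?mem_t.
have rkI a b : a \in s -> b \in s -> a != b -> rk a != rk b.
  by move=> sa sb; apply: contra_neq => E; rewrite -(nr a sa) E nr.
have rx := rs _ xs; have ry := rs _ ys; have rz := rs _ zs.
have [U|U] := boolP (uniq [:: x; y; z]); last first.
  have -> : o x y z = false by apply/negP => /(ot_uniq ot); rewrite (negPf U).
  rewrite /alt3; move: U; rewrite /= !inE !andbT negb_and negbK negbK.
  by move=> /orP[/orP[]|] /eqP->; rewrite ?ltnn ?if_same //; case: ltngtP.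
have E1 := ot_anti ot U.
have E2 : o y z x = o x y z by rewrite (ot_cyc ot x).
have E3 : o z x y = o x y z by rewrite -(ot_cyc ot z).
have E4 : o x z y = ~~ o x y z by rewrite -E1 (ot_cyc ot y).
have E5 : o z y x = ~~ o x y z by rewrite -E1 -(ot_cyc ot z).
move: U; rewrite /= !inE negb_or !andbT => /andP[/andP[xy xz] yz].
move: (rkI _ _ xs ys xy) (rkI _ _ xs zs xz) (rkI _ _ ys zs yz) => {xy xz yz}.
rewrite /alt3.
case: (ltngtP (rk x) (rk y)) => // xy _; case: (ltngtP (rk x) (rk z)) => // xz _;
  case: (ltngtP (rk y) (rk z)) => // yz _ /=; try (by clear -xy xz yz; lia);
  rewrite sgE ?nr ?E1 ?E2 ?E3 ?E4 ?E5 ?negbK //; clear -xy xz yz rx ry rz; lia.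
Qed.

(* Configurations of at most five points are checked exhaustively: after sorting
   by [lt], such a configuration is one of the finitely many signotopes. *)
Lemma order_type_decide g f : holds_on_signotopes (size s) g f ->
  g (get2 (tab2 lt s)) -> f (get2 (tab2 lt s)) (get3 (tab3 o s)).
Proof.
move=> /allP /(_ [seq rk x | x <- s]).
rewrite mem_permutations.
have -> : perm_eq [seq rk x | x <- s] (iota 0 (size s)).
  have -> : iota 0 (size s) = map rk t.
    apply: (@eq_from_nth _ 0); rewrite ?size_iota ?size_map ?size_sort// => i i_s.
    by rewrite (nth_map x0) ?size_sort// nth_iota// /rk index_uniq ?size_sort.
  by apply: perm_map; rewrite perm_sym perm_sort.
have -> : tab2 ltn [seq rk x | x <- s] = tab2 lt s.
  rewrite /tab2 -map_comp; apply/eq_in_map => x xs /=; rewrite -map_comp.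
  by apply/eq_in_map => y ys /=; exact: rk_lt.
move=> /(_ isT) /implyP H /H; rewrite all_map => /allP /(_ sg).
rewrite mem_filter sg_signotope.
have -> : size (triples (size s)) = size sg by rewrite size_map.
rewrite mem_bitseqs => /(_ isT).
rewrite -[preim _ _ _]/(f _ (get3 (tab3 (get3 _) _))); set c := get3 (tab3 _ (iota _ _)).
suff -> : tab3 c [seq rk x | x <- s] = tab3 o s by [].
have rks x : x \in s -> rk x < size s by rewrite -(size_sort le s) index_mem mem_t.
rewrite /tab3 -map_comp; apply/eq_in_map => x xs /=; rewrite -map_comp.
apply/eq_in_map => y ys /=; rewrite -map_comp.
apply/eq_in_map => z zs /=; rewrite -altE // /c /get3 /tab3.
rewrite !(nth_map 0) ?size_map ?size_iota ?nth_iota ?rks //.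
Qed.

End Rank.

End OT.

(** For distinct points: each of the two lines separates the endpoints of the other segment. *)
Definition cross4 (T : Type) (o : T -> T -> T -> bool) u v x y : bool :=
  (o u v x != o u v y) && (o x y u != o x y v).

(** Transitivity is asked of distinct elements only, because it will be applied to angular orders
    given by [o], which is false on repeated points. *)
Lemma fin_minimum (T : finType) (P : pred T) (r : rel T) :
    (exists x, P x) ->
    (forall x y, P x -> P y -> x != y -> r x y || r y x) ->
    (forall x y z, P x -> P y -> P z -> uniq [:: x; y; z] -> r x y -> r y z -> r x z) ->
  exists2 m, P m & forall x, P x -> x != m -> r m x.
Proof.
move=> [x0 Px0] tot tr.
suff H (s : seq T) : all P s -> s != [::] ->
    exists2 m, m \in s & forall x, x \in s -> x != m -> r m x.
  have [||m] := H (enum P); first by apply/allP => x; rewrite mem_enum.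
    by apply/eqP => E; have : x0 \in enum P; [rewrite mem_enum | rewrite E].
  by rewrite mem_enum => Pm mP; exists m => // x Px; apply: mP; rewrite mem_enum.
elim: s => //= x s IH /andP[Px /[dup] /allP sP /IH {}IH] _.
have [->|/IH [m ms mP]] := eqVneq s [::].
  by exists x; rewrite ?inE// => y; rewrite inE => ->.
have [E|xm] := eqVneq x m.
  exists m; first by rewrite inE ms orbT.
  by move=> y; rewrite inE E => /orP[->//|]; apply: mP.
have /orP[rxm|rmx] := tot _ _ Px (sP _ ms) xm; [exists x|exists m].
- by rewrite inE eqxx.
- move=> y; rewrite inE => /orP[->//|ys] yx.
  have [->//|ym] := eqVneq y m.
  apply: (tr x m y) => //; [exact: sP|exact: sP| |exact: mP].
  by rewrite /= !inE negb_or xm !(eq_sym _ y) yx ym.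
- by rewrite inE ms orbT.
- by move=> y; rewrite inE => /orP[/eqP->//|]; apply: mP.
Qed.

(** Choosing one [y] for each [x] gives an injection. This form suits a charging scheme given by a
    relation. *)
Lemma leq_card_rel (X Y : finType) (A : {set X}) (B : {set Y}) (R : X -> Y -> Prop) :
    (forall x, x \in A -> exists2 y, y \in B & R x y) ->
    (forall x x' y, x \in A -> x' \in A -> R x y -> R x' y -> x = x') ->
  #|A| <= #|B|.
Proof.
move=> AB inj; have [->|[a aA]] := set_0Vmem A; first by rewrite cards0.
have [b _ _] := AB a aA.
have [f fP] : exists f : X -> Y, forall x, x \in A -> f x \in B /\ R x (f x).
  apply: (@fin_all_exists _ (fun=> Y) (fun x y => x \in A -> y \in B /\ R x y)) => x.
  by have [/AB[y yB Rxy]|_] := boolP (x \in A); [exists y|exists b].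
have fI : {in A &, injective f}.
  by move=> x y xA yA E; apply: (inj x y (f x)) => //; [|rewrite E]; apply: (fP _ _).2.
rewrite -(card_in_imset fI); apply/subset_leq_card/subsetP => _ /imsetP[x xA ->].
exact: (fP x xA).1.
Qed.

(** * Configurations of four or five points *)

Section Plane.
Variables (V : finType) (lt : rel V) (o : V -> V -> V -> bool).
Hypothesis ot : order_type lt o.

Definition segments_cross u v x y := uniq [:: u; v; x; y] && cross4 o u v x y.

(** The number [i] in [g] and [f] names entry [i] of the list [s]; [g] is the assumption on the
    sweep order under which [f] is checked. *)
Ltac decide_ot s g f :=
  let H := fresh in let U := fresh in
  have H : holds_on_signotopes (size s) g f; [by vm_compute | move=> U; exact: (order_type_decide ot (head _ s) U H)].

Ltac decide_ot0 s f :=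
  let H := fresh in let U := fresh in
  have H : holds_on_signotopes (size s) (fun _ : nat -> nat -> bool => true) (fun _ : nat -> nat -> bool => f);
    [by vm_compute | move=> U; exact: (order_type_decide ot (head _ s) U H isT)].

Lemma crossesC u v x y : segments_cross u v x y = segments_cross x y u v.
Proof.
rewrite /segments_cross /cross4 andbC [X in X && _]andbC andbC; congr (_ && _).
by rewrite -(rot_uniq 2).
Qed.

Lemma cross4l u v x y : uniq [:: u; v; x; y] -> cross4 o u v x y == cross4 o v u x y.
Proof. decide_ot0 [:: u; v; x; y] (fun O => cross4 O 0 1 2 3 == cross4 O 1 0 2 3). Qed.

Lemma crossesl u v x y : segments_cross u v x y = segments_cross v u x y.
Proof.
rewrite /segments_cross; have -> : uniq [:: v; u; x; y] = uniq [:: u; v; x; y].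
  by apply: perm_uniq; rewrite -[[:: v, u & _]]/([:: v] ++ [:: u] ++ [:: x; y]) perm_catCA.
by case U : (uniq _) => //=; apply/eqP/cross4l.
Qed.

Lemma crossesr u v x y : segments_cross u v x y = segments_cross u v y x.
Proof. by rewrite crossesC crossesl crossesC. Qed.

(* In the [cone_*] and [charge_*] lemmas, [u] lies above [w] as seen from their
   common right neighbour [v], and [m] between the two. *)
Lemma cone_above u m v p q : uniq [:: u; m; v; p; q] ->
  [&& lt u m, lt m v & lt p q] ->
  [&& cross4 o p q m v, o u m v & o p q m] ==>
    cross4 o p q u v || [&& lt q v, o u q v & o q m v].
Proof.
decide_ot [:: u; m; v; p; q] (fun L => [&& L 0 1, L 1 2 & L 3 4])
  (fun L O => [&& cross4 O 3 4 1 2, O 0 1 2 & O 3 4 1] ==>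
    cross4 O 3 4 0 2 || [&& L 4 2, O 0 4 2 & O 4 1 2]).
Qed.

Lemma cone_above_apex u m v q : uniq [:: u; m; v; q] ->
  [&& lt u m, lt m v & lt u q] ->
  [&& cross4 o u q m v, o u m v & o u q m] ==> false.
Proof.
decide_ot [:: u; m; v; q] (fun L => [&& L 0 1, L 1 2 & L 0 3])
  (fun (L : nat -> nat -> bool) O => [&& cross4 O 0 3 1 2, O 0 1 2 & O 0 3 1] ==> false).
Qed.

Lemma cone_below w m v p q : uniq [:: w; m; v; p; q] ->
  [&& lt w m, lt m v & lt p q] ->
  [&& cross4 o p q m v, o m w v & ~~ o p q m] ==>
    cross4 o p q w v || [&& lt q v, o q w v & o m q v].
Proof.
decide_ot [:: w; m; v; p; q] (fun L => [&& L 0 1, L 1 2 & L 3 4])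
  (fun L O => [&& cross4 O 3 4 1 2, O 1 0 2 & ~~ O 3 4 1] ==>
    cross4 O 3 4 0 2 || [&& L 4 2, O 4 0 2 & O 1 4 2]).
Qed.

Lemma cone_below_apex w m v q : uniq [:: w; m; v; q] ->
  [&& lt w m, lt m v & lt w q] ->
  [&& cross4 o w q m v, o m w v & ~~ o w q m] ==> false.
Proof.
decide_ot [:: w; m; v; q] (fun L => [&& L 0 1, L 1 2 & L 0 3])
  (fun (L : nat -> nat -> bool) O => [&& cross4 O 0 3 1 2, O 1 0 2 & ~~ O 0 3 1] ==> false).
Qed.

Lemma cross_sorted p q m v : uniq [:: p; q; m; v] -> [&& lt p q, lt q m & lt m v] ->
  ~~ cross4 o p q m v.
Proof.
decide_ot [:: p; q; m; v] (fun L => [&& L 0 1, L 1 2 & L 2 3])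
  (fun (L : nat -> nat -> bool) O => ~~ cross4 O 0 1 2 3).
Qed.

(** All points before [v] lie in a half plane bounded by a line through [v], where the angular order
    round [v] is linear. *)
Lemma left_trans v x y z : uniq [:: v; x; y; z] -> [&& lt x v, lt y v & lt z v] ->
  o x y v && o y z v ==> o x z v.
Proof.
decide_ot [:: v; x; y; z] (fun L => [&& L 1 0, L 2 0 & L 3 0])
  (fun (L : nat -> nat -> bool) O => O 1 2 0 && O 2 3 0 ==> O 1 3 0).
Qed.

Lemma right_trans v x y z : uniq [:: v; x; y; z] -> [&& lt v x, lt v y & lt v z] ->
  o v x y && o v y z ==> o v x z.
Proof.
decide_ot [:: v; x; y; z] (fun L => [&& L 0 1, L 0 2 & L 0 3])
  (fun (L : nat -> nat -> bool) O => O 0 1 2 && O 0 2 3 ==> O 0 1 3).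
Qed.

Lemma charge_down_near w u v' v : uniq [:: w; u; v'; v] -> [&& lt w u, lt u v' & lt v' v] ->
  [&& o u v' v, ~~ o v' w v & o u w v] ==> cross4 o u v' w v.
Proof.
decide_ot [:: w; u; v'; v] (fun L => [&& L 0 1, L 1 2 & L 2 3])
  (fun (L : nat -> nat -> bool) O => [&& O 1 2 3, ~~ O 2 0 3 & O 1 0 3] ==> cross4 O 1 2 0 3).
Qed.

Lemma charge_down_far w u v v' : uniq [:: w; u; v; v'] -> [&& lt w u, lt u v & lt v v'] ->
  o u w v && o u v' v ==> cross4 o w v u v'.
Proof.
decide_ot [:: w; u; v; v'] (fun L => [&& L 0 1, L 1 2 & L 2 3])
  (fun (L : nat -> nat -> bool) O => O 1 0 2 && O 1 3 2 ==> cross4 O 0 2 1 3).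
Qed.

Lemma charge_up_near u w v' v : uniq [:: u; w; v'; v] -> [&& lt u w, lt w v' & lt v' v] ->
  [&& o w v v', ~~ o u v' v & o u w v] ==> cross4 o w v' u v.
Proof.
decide_ot [:: u; w; v'; v] (fun L => [&& L 0 1, L 1 2 & L 2 3])
  (fun (L : nat -> nat -> bool) O => [&& O 1 3 2, ~~ O 0 2 3 & O 0 1 3] ==> cross4 O 1 2 0 3).
Qed.

Lemma charge_up_far u w v v' : uniq [:: u; w; v; v'] -> [&& lt u w, lt w v & lt v v'] ->
  o u w v && o w v v' ==> cross4 o u v w v'.
Proof.
decide_ot [:: u; w; v; v'] (fun L => [&& L 0 1, L 1 2 & L 2 3])
  (fun (L : nat -> nat -> bool) O => O 0 1 2 && O 1 2 3 ==> cross4 O 0 2 1 3).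
Qed.

Lemma lower_hull_free a m w v : uniq [:: a; m; w; v] -> [&& lt a m, lt w m & lt m v] ->
  [&& o m w v, o a m w & o a m v] ==> false.
Proof.
decide_ot [:: a; m; w; v] (fun L => [&& L 0 1, L 2 1 & L 1 3])
  (fun (L : nat -> nat -> bool) O => [&& O 1 2 3, O 0 1 2 & O 0 1 3] ==> false).
Qed.

Lemma upper_hull_free a b u v : uniq [:: a; b; u; v] -> [&& lt b a, lt u a & lt a v] ->
  [&& o u a v, o a b u & o a b v] ==> false.
Proof.
decide_ot [:: a; b; u; v] (fun L => [&& L 1 0, L 2 0 & L 0 3])
  (fun (L : nat -> nat -> bool) O => [&& O 2 0 3, O 0 1 2 & O 0 1 3] ==> false).
Qed.

Lemma hull_trans c a x y z : uniq [:: c; a; x; y; z] ->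
  [&& o c a x, o c a y, o c a z, o a x y & o a y z] ==> o a x z.
Proof.
decide_ot0 [:: c; a; x; y; z] (fun O =>
  [&& O 0 1 2, O 0 1 3, O 0 1 4, O 1 2 3 & O 1 3 4] ==> O 1 2 4).
Qed.

(** The line [x b] separates [a] from [p] and [q], and [a x] meets this line only in [x]. *)
Lemma ear_uncrossed a x b p q : uniq [:: a; x; b; p; q] ->
  [&& o b x a, o x b p & o x b q] ==> ~~ cross4 o a x p q.
Proof.
decide_ot0 [:: a; x; b; p; q] (fun O =>
  [&& O 2 1 0, O 1 2 3 & O 1 2 4] ==> ~~ cross4 O 0 1 3 4).
Qed.

Lemma ear_uncrossed_end a x b q : uniq [:: a; x; b; q] ->
  o b x a && o x b q ==> ~~ cross4 o a x b q.
Proof.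
decide_ot0 [:: a; x; b; q] (fun O => O 2 1 0 && O 1 2 3 ==> ~~ cross4 O 0 1 2 3).
Qed.

(** Both segments leave the triangle [a x y] through the side opposite to their starting vertex, and
    two such cevians meet inside the triangle. *)
Lemma two_exits_cross a x y p q : uniq [:: a; x; y; p; q] ->
  cross4 o x p a y && cross4 o a q x y ==> cross4 o x p a q.
Proof.
decide_ot0 [:: a; x; y; p; q] (fun O =>
  cross4 O 1 3 0 2 && cross4 O 0 4 1 2 ==> cross4 O 1 3 0 4).
Qed.

(** The two cevians would meet inside the triangle and again in [p]. *)
Lemma two_exits_distinct a x y p : uniq [:: a; x; y; p] ->
  cross4 o x p a y && cross4 o a p x y ==> false.
Proof.
decide_ot0 [:: a; x; y; p] (fun O => cross4 O 1 3 0 2 && cross4 O 0 3 1 2 ==> false).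
Qed.

End Plane.

(** * Size of a maximal plane set of segments *)

Section MaxPlane.
Variables (V : finType) (lt : rel V) (o : V -> V -> V -> bool).
Hypothesis ot : order_type lt o.
Local Notation crosses := (segments_cross o).

Lemma ot_neq u v : lt u v -> u != v.
Proof. by apply: contraTneq => ->; rewrite (ot_irr ot). Qed.

Lemma ot_asym u v : lt u v -> lt v u = false.
Proof. by move=> uv; apply/negP => /(ot_trans ot uv); rewrite (ot_irr ot). Qed.

Lemma o_asym u v w : o u v w -> o v u w = false.
Proof. by move=> H; rewrite (ot_anti ot (ot_uniq ot H)) H. Qed.

Lemma o_total u v w : uniq [:: u; v; w] -> o u v w || o v u w.
Proof. by move=> U; rewrite (ot_anti ot U) orbN. Qed.

Lemma o_total_r u v w : uniq [:: u; v; w] -> o u v w || o u w v.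
Proof. by move=> U; rewrite (ot_cyc ot u v) (ot_cyc ot u w) o_total // -(rot_uniq 2). Qed.

(** Each segment is stored once, as the pair with its left end first. *)
Record maxplane (M : {set V * V}) : Prop := MaxPlane {
  mp_lt : forall u v, (u, v) \in M -> lt u v;
  mp_plane : forall u v x y, (u, v) \in M -> (x, y) \in M -> ~~ crosses u v x y;
  mp_max : forall p q, lt p q -> (p, q) \notin M ->
    exists u v, (u, v) \in M /\ crosses u v p q }.

Lemma maxplane_exists (L : {set V * V}) :
    (forall u v, (u, v) \in L -> lt u v) ->
    (forall u v x y, (u, v) \in L -> (x, y) \in L -> ~~ crosses u v x y) ->
  exists2 M, maxplane M & L \subset M.
Proof.
move=> Llt Lnc.
pose P (M : {set V * V}) := [forall e in M, lt e.1 e.2 &&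
   [forall f in M, ~~ crosses e.1 e.2 f.1 f.2]].
have PL : P L.
  apply/forall_inP => -[u v] uv; rewrite Llt //=.
  by apply/forall_inP => -[x y] xy; apply: Lnc.
have [M /maxsetP[PM Mmax] LM] := maxset_exists PL; exists M => //.
have ltM u v : (u, v) \in M -> lt u v by move=> /(forall_inP PM)/andP[].
have ncM u v x y : (u, v) \in M -> (x, y) \in M -> ~~ crosses u v x y.
  by move=> /(forall_inP PM)/andP[_ /forall_inP H] /H.
split=> // p q pq pqM.
have [/existsP[[u v] /andP[uvM H]]|none] :=
  boolP [exists e, (e \in M) && crosses e.1 e.2 p q]; first by exists u, v.
have none' u v : (u, v) \in M -> ~~ crosses u v p q.
  by move=> uvM; apply: contra none => H; apply/existsP; exists (u, v); rewrite uvM.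
case/negP: pqM; rewrite -(Mmax ((p, q) |: M)) ?setU11 ?subsetU1 //.
apply/forall_inP => -[u v] /setU1P[[-> ->]|uvM] /=.
  rewrite pq; apply/forall_inP => -[x y] /setU1P[[-> ->]|xyM] /=.
    by rewrite /segments_cross /= !inE eqxx !orbT.
  by rewrite (crossesC o) none'.
rewrite ltM //; apply/forall_inP => -[x y] /setU1P[[-> ->]|xyM] /=; first exact: none'.
exact: ncM.
Qed.

Ltac lt_tac := solve [assumption | match goal with
  H : is_true (lt ?a ?b) |- is_true (lt ?a ?c) => solve [apply: (ot_trans ot H); lt_tac] end].
Ltac ne_tac := first [assumption | by rewrite eq_sym | apply: ot_neq; lt_tac |
   rewrite eq_sym; apply: ot_neq; lt_tac].
Ltac uniq_tac := rewrite /= !inE !negb_or; repeat (apply/andP; split); try done; ne_tac.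

Variable M : {set V * V}.
Hypothesis Mmax : maxplane M.

Lemma maxplane_noncross u v x y : (u, v) \in M -> (x, y) \in M ->
  uniq [:: u; v; x; y] -> cross4 o u v x y = false.
Proof.
by move=> uv xy U; have := mp_plane Mmax uv xy; rewrite /segments_cross U => /negPf.
Qed.

(** By [none], [m v] is not in [M], so some [p q] in [M] crosses it. As [p q] crosses neither side
    of the cone, it ends inside the cone at a point [q] not to the left of [m], although [m] is the
    rightmost point there. *)
Lemma cone_vertex u w v m : (u, v) \in M -> (w, v) \in M ->
    (forall x, (x, v) \in M -> o u x v -> o x w v -> False) ->
    lt u m -> lt w m -> lt m v -> o u m v -> o m w v ->
    (forall x, lt x v -> o u x v -> o x w v -> x != m -> lt x m) -> False.
Proof.
move=> uvM wvM none um wm mv omu omw mlast.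
have uv := ot_trans ot um mv; have wv := ot_trans ot wm mv.
have mvM : (m, v) \notin M by apply/negP => /none; apply.
have [p [q [pqM /andP[U cr]]]] := mp_max Mmax mv mvM.
have pq := mp_lt Mmax pqM.
have [pm pv qm qv] : [/\ p != m, p != v, q != m & q != v].
  by move: U; rewrite /= !inE !negb_or; case/and4P=> /and3P[_ -> ->] /andP[-> ->].
have qnm : ~ lt q m.
  by move=> q_m; have := cross_sorted ot U; rewrite pq q_m mv cr => /(_ isT).
have qu : q != u by apply/eqP => E; apply: qnm; rewrite E.
have qw : q != w by apply/eqP => E; apply: qnm; rewrite E.
have wu : u != w.
  by apply/eqP => E; move: omu; rewrite E (o_asym omw).
have [above|below] := boolP (o p q m).
- have pu : p != u.
    apply/eqP => E; move: above cr pq pm pv; rewrite E => above cr uq pm pv.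
    have U4 : uniq [:: u; m; v; q] by uniq_tac.
    by have := cone_above_apex ot U4; rewrite um mv uq cr omu above => /(_ isT).
  have U5 : uniq [:: u; m; v; p; q] by uniq_tac.
  have := cone_above ot U5; rewrite um mv pq cr omu above => /(_ isT) /=.
  rewrite (maxplane_noncross pqM uvM) ?orFb; last by uniq_tac.
  move=> /and3P[ltqv ouq oqm].
  have U4 : uniq [:: v; q; m; w] by uniq_tac.
  have := left_trans ot U4; rewrite ltqv mv wv oqm omw => /(_ isT) oqw.
  by apply: qnm; apply: mlast.
- have pw : p != w.
    apply/eqP => E; move: below cr pq pm pv; rewrite E => below cr uq pm pv.
    have U4 : uniq [:: w; m; v; q] by uniq_tac.
    by have := cone_below_apex ot U4; rewrite wm mv uq cr omw below => /(_ isT).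
  have U5 : uniq [:: w; m; v; p; q] by uniq_tac.
  have := cone_below ot U5; rewrite wm mv pq cr omw below => /(_ isT) /=.
  rewrite (maxplane_noncross pqM wvM) ?orFb; last by uniq_tac.
  move=> /and3P[ltqv oqw omq].
  have U4 : uniq [:: v; u; m; q] by uniq_tac.
  have := left_trans ot U4; rewrite ltqv mv uv omq omu => /(_ isT) ouq.
  by apply: qnm; apply: mlast.
Qed.

(* A segment [e] that is not the lowest one arriving at [e.2] from the left is
   charged to the rightmost vertex [m] of the cone below it, with [true] if [m] is the
   upper and [false] if [m] is the lower left end; in a triangulation this counts every
   triangle at its middle vertex. Each vertex is charged at most once from below and
   once from above, and hull edges forbid the charges on their outer side. *)
Definition charge (e : V * V) (c : V * bool) : Prop := exists w,
  [/\ (w, e.2) \in M, o e.1 w e.2,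
      forall x, (x, e.2) \in M -> o e.1 x e.2 -> o x w e.2 -> False,
      forall x, lt x e.2 -> o e.1 x e.2 -> o x w e.2 -> lt x c.1 &
      if c.2 then c.1 = e.1 /\ lt w e.1 else c.1 = w /\ lt e.1 w].

Lemma charge_exists u w v : (u, v) \in M -> (w, v) \in M -> o u w v ->
  exists c, charge (u, v) c.
Proof.
move=> uvM wvM ouw.
(* [w1] is the left end of the segment next below [u v] among those arriving at [v]. *)
have [||x y z|w1 /andP[w1M ouw1] w1max] :=
  @fin_minimum _ (fun w => ((w, v) \in M) && o u w v) (fun x y => o x y v).
- by exists w; rewrite wvM.
- move=> x y /andP[/(mp_lt Mmax) xv _] /andP[/(mp_lt Mmax) yv _] xy.
  by apply: o_total; uniq_tac.
- move=> /andP[/(mp_lt Mmax) xv _] /andP[/(mp_lt Mmax) yv _] /andP[/(mp_lt Mmax) zv _] U xy yz.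
  have U4 : uniq [:: v; x; y; z].
    by rewrite cons_uniq U andbT !inE !negb_or !(eq_sym v) !ot_neq.
  by have := left_trans ot U4; rewrite xv yv zv xy yz => /(_ isT).
have none x : (x, v) \in M -> o u x v -> o x w1 v -> False.
  move=> xvM oux oxw; have := w1max x; rewrite xvM oux => /(_ isT).
  rewrite (o_asym oxw); suff -> : x != w1 by move=> /(_ isT).
  by have := ot_uniq ot oxw; rewrite /= !inE negb_or => /andP[/andP[]].
have uv := mp_lt Mmax uvM; have w1v := mp_lt Mmax w1M.
have uw1 : u != w1.
  by have := ot_uniq ot ouw1; rewrite /= !inE negb_or => /andP[/andP[]].
(* The cone together with its two left ends. Its rightmost point is one of these ends by
   [cone_vertex], and which one decides the flag of the charge. *)
pose C x := lt x v && [|| x == u, x == w1 | o u x v && o x w1 v].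
have [|x y _ _ xy|x y z _ _ _ _ yx zy|m Cm mlast] := @fin_minimum _ C (fun x y => lt y x).
- by exists u; rewrite /C uv eqxx.
- by rewrite orbC; apply: (ot_total ot).
- exact: (ot_trans ot zy yx).
have mlast' x : lt x v -> o u x v -> o x w1 v -> x != m -> lt x m.
  by move=> xv oux oxw; apply: mlast; rewrite /C xv oux oxw !orbT.
have Cu : C u by rewrite /C uv eqxx.
have Cw : C w1 by rewrite /C w1v eqxx orbT.
case/andP: Cm => mv /or3P[/eqP E|/eqP E|/andP[oum omw]].
- exists (u, true), w1; split => //=.
    by move=> x xv oux oxw; rewrite -E; apply: mlast' => //; rewrite E;
      have := ot_uniq ot oux; rewrite /= !inE negb_or (eq_sym u) => /andP[/andP[]].
  by split => //; rewrite -E; apply: mlast => //; rewrite E eq_sym.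
- exists (w1, false), w1; split => //=.
    by move=> x xv oux oxw; rewrite -E; apply: mlast' => //; rewrite E;
      have := ot_uniq ot oxw; rewrite /= !inE negb_or => /andP[/andP[]].
  by split => //; rewrite -E; apply: mlast => //; rewrite E.
have [um mw] : u != m /\ m != w1.
  have := ot_uniq ot oum; have := ot_uniq ot omw.
  by rewrite /= !inE !negb_or => /andP[/andP[]-> _ _] /andP[/andP[]->].
case: (@cone_vertex u w1 v m) => //; apply: mlast => //.
by rewrite eq_sym.
Qed.

(** If [v'] is left of [v], it lies below [w v], since the cone has no point to the right of [u];
    then [u v'] crosses [w v]. If [v'] is right of [v], the two segments cross as well. *)
Lemma charge_down_unique u w v v' : (u, v) \in M -> (w, v) \in M -> (u, v') \in M ->
    o u w v -> lt w u ->
    (forall x, lt x v -> o u x v -> o x w v -> lt x u) ->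
  o u v' v -> False.
Proof.
move=> uvM wvM uvM' ouw wu cone ouv.
have uv := mp_lt Mmax uvM; have uv' := mp_lt Mmax uvM'.
have vv' : v' != v.
  by have := ot_uniq ot ouv; rewrite /= !inE negb_or => /and3P[_ ->].
have /orP[v'v|vv''] := ot_total ot vv'.
- have nin : ~~ o v' w v.
    by apply/negP => /(cone _ v'v ouv) /(ot_trans ot uv'); rewrite (ot_irr ot).
  have U4 : uniq [:: w; u; v'; v] by uniq_tac.
  have := charge_down_near ot U4; rewrite wu uv' v'v ouv nin ouw => /(_ isT) /=.
  by rewrite (maxplane_noncross uvM' wvM) //; uniq_tac.
- have U4 : uniq [:: w; u; v; v'] by uniq_tac.
  have := charge_down_far ot U4; rewrite wu uv vv'' ouv ouw => /(_ isT) /=.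
  by rewrite (maxplane_noncross wvM uvM') //; uniq_tac.
Qed.

(** The mirror image of [charge_down_unique], with the lower left end [w] as the charged vertex. *)
Lemma charge_up_unique u w v v' : (u, v) \in M -> (w, v) \in M -> (w, v') \in M ->
    o u w v -> lt u w ->
    (forall x, lt x v -> o u x v -> o x w v -> lt x w) ->
  o w v v' -> False.
Proof.
move=> uvM wvM wvM' ouw uw cone owv.
have wv := mp_lt Mmax wvM; have wv' := mp_lt Mmax wvM'.
have vv' : v != v'.
  by have := ot_uniq ot owv; rewrite /= !inE negb_or => /and3P[_ ->].
have /orP[vv''|v'v] := ot_total ot vv'.
- have U4 : uniq [:: u; w; v; v'] by uniq_tac.
  have := charge_up_far ot U4; rewrite uw wv vv'' owv ouw => /(_ isT) /=.
  by rewrite (maxplane_noncross uvM wvM') //; uniq_tac.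
- have nin : ~~ o u v' v.
    apply/negP => ouv; have := cone _ v'v ouv.
    by rewrite -2!(ot_cyc ot) owv => /(_ isT); rewrite (ot_asym wv').
  have U4 : uniq [:: u; w; v'; v] by uniq_tac.
  have := charge_up_near ot U4; rewrite uw wv' v'v owv nin ouw => /(_ isT) /=.
  by rewrite (maxplane_noncross wvM' uvM) //; uniq_tac.
Qed.

Lemma charge_inj e e' c : e \in M -> e' \in M -> charge e c -> charge e' c -> e = e'.
Proof.
case: e e' c => [u v] [u' v'] [m b] eM e'M.
move=> [w [/= wM ouw none cone H]] [w' [/= w'M ouw' none' cone' H']].
case: b H H' => -[/esym E lt_wu] [/esym E' lt_wu']; subst.
- have [-> //|vv'] := eqVneq v v'.
  have /orP[H|H] : o m v' v || o m v v'.
    apply: o_total_r; have := mp_lt Mmax eM; have := mp_lt Mmax e'M; move=> *; uniq_tac.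
  + by case: (charge_down_unique eM wM e'M ouw lt_wu cone H).
  + by case: (charge_down_unique e'M w'M eM ouw' lt_wu' cone' H).
- have [E|vv'] := eqVneq v v'; last first.
    have /orP[H|H] : o m v v' || o m v' v.
      apply: o_total_r; have := mp_lt Mmax wM; have := mp_lt Mmax w'M; move=> *; uniq_tac.
    + by case: (charge_up_unique eM wM w'M ouw lt_wu cone H).
    + by case: (charge_up_unique e'M w'M wM ouw' lt_wu' cone' H).
  (* With the same right end and the same lower neighbour [m], the lower of the two segments would
     lie between the other one and [m]. *)
  subst; have [-> //|uu'] := eqVneq u u'.
  have uv := mp_lt Mmax eM; have uv' := mp_lt Mmax e'M.
  have /orP[H|H] : o u u' v' || o u' u v' by apply: o_total; uniq_tac.
  + by case: (none u').
  + by case: (none' u).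
Qed.

(** A hull edge directed to the right lies on the lower hull, while a charge with [true] would put
    [m] above the segment [w v]. *)
Lemma charge_not_lower e a m : e \in M -> lt a m ->
  (forall d, d != a -> d != m -> o a m d) -> ~ charge e (m, true).
Proof.
case: e => u v uvM am hull [w [/= wM ouw _ _ [E wu]]]; subst u.
have mv := mp_lt Mmax uvM.
have oamv : o a m v by apply: hull; ne_tac.
have [E|wa] := eqVneq w a.
  by move: ouw; rewrite E (o_asym oamv).
have oamw : o a m w by apply: hull; ne_tac.
have U : uniq [:: a; m; w; v] by uniq_tac.
by have := lower_hull_free ot U; rewrite am wu mv ouw oamv oamw => /(_ isT).
Qed.

(** A hull edge directed to the left lies on the upper hull, while a charge with [false] would put
    [a] below the segment [u v]. *)
Lemma charge_not_upper e a b : e \in M -> lt b a ->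
  (forall d, d != a -> d != b -> o a b d) -> ~ charge e (a, false).
Proof.
case: e => u v uvM ba hull [w [/= wM ouw _ _ [E uw]]]; subst w.
have av := mp_lt Mmax wM.
have oabv : o a b v by apply: hull; ne_tac.
have [E|ub] := eqVneq u b.
  by move: ouw; rewrite E (o_asym oabv).
have oabu : o a b u by apply: hull; ne_tac.
have U : uniq [:: a; b; u; v] by uniq_tac.
by have := upper_hull_free ot U; rewrite ba uw av ouw oabv oabu => /(_ isT).
Qed.

(* Hull edges are directed counterclockwise. *)
Definition hull_edges : {set V * V} :=
  [set e | (e.1 != e.2) && [forall d, (d != e.1) ==> (d != e.2) ==> o e.1 e.2 d]].

Lemma hull_edgesP a b : reflect (a != b /\ forall d, d != a -> d != b -> o a b d)
  ((a, b) \in hull_edges).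
Proof.
rewrite inE /=; apply: (iffP andP) => -[ab H]; split => //.
  by move=> d da db; have := forallP H d; rewrite da db.
by apply/forallP => d; apply/implyP => da; apply/implyP => db; apply: H.
Qed.

(** The charge that a hull edge forbids: its right end, with [true] on the lower hull and [false] on
    the upper hull. *)
Definition hull_code (e : V * V) : V * bool := if lt e.1 e.2 then (e.2, true) else (e.1, false).

Lemma hull_code_inj : {in hull_edges &, injective hull_code}.
Proof.
move=> [a b] [c d] /hull_edgesP[ab H] /hull_edgesP[cd K]; rewrite /hull_code /=.
case: ifP => lab; case: ifP => lcd // -[E]; subst.
- have [-> //|ac] := eqVneq a c.
  have := H c; rewrite (eq_sym c) ac cd => /(_ isT isT) /(o_asym).
  by rewrite -(ot_cyc ot c) K // eq_sym.
- have [-> //|bd] := eqVneq b d.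
  have := H d; rewrite !(eq_sym d) cd bd => /(_ isT isT).
  by move=> /o_asym; rewrite (ot_cyc ot) K // eq_sym.
Qed.

(** At most [#|V| - 1] segments are lowest at their right end, since none ends at the leftmost
    vertex [l]. The others are charged injectively to the [2 * #|V|] pairs of a vertex and a flag,
    except the two pairs at [l] and the codes of the hull edges. *)
Lemma card_maxplane : 0 < #|V| -> #|M| + #|hull_edges| + 3 <= 3 * #|V|.
Proof.
move=> /card_gt0P[x0 _].
have [|x y _ _ xy|x y z _ _ _ _ yx zy|l _ lmin] := @fin_minimum _ predT lt.
- by exists x0.
- exact: (ot_total ot).
- exact: (ot_trans ot yx zy).
pose low := [set e in M | [forall w, ((w, e.2) \in M) ==> ~~ o e.1 w e.2]].
have card_low : #|low| < #|V|.
  have inj : {in low &, injective (fun e : V * V => e.2)}.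
    move=> [u v] [u' v'] /=; rewrite !inE /= => /andP[uvM /forallP H] /andP[uvM' /forallP H'] E; subst v'.
    have [-> //|uu'] := eqVneq u u'.
    have /orP[K|K] : o u u' v || o u' u v.
      by apply: o_total; have := mp_lt Mmax uvM; have := mp_lt Mmax uvM'; move=> *; uniq_tac.
    + by have /implyP/(_ uvM') := H u'; rewrite /= K.
    + by have /implyP/(_ uvM) := H' u; rewrite /= K.
  rewrite -(card_in_imset inj); apply: leq_ltn_trans (_ : #|[set~ l]| < _); last first.
    by rewrite cardsC1; have : 0 < #|V| by [apply/card_gt0P; exists l]; lia.
  apply/subset_leq_card/subsetP => _ /imsetP[[u v] + ->]; rewrite !inE /= => /andP[/(mp_lt Mmax) uv _].
  apply/eqP => E; subst v; have [ul|ul] := eqVneq u l.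
    by move: uv; rewrite ul (ot_irr ot).
  by have := lmin u isT ul; rewrite (ot_asym uv).
pose bad := (l, true) |: ((l, false) |: [set hull_code e | e in hull_edges]).
have card_bad : #|bad| = #|hull_edges| + 2.
  have lh b : (l, b) \notin [set hull_code e | e in hull_edges].
    apply/imsetP => -[[a c] /hull_edgesP[ac _]]; rewrite /hull_code /=.
    case: ifP => [lac|lac] [E _]; subst.
      by have := lmin a isT ac; rewrite (ot_asym lac).
    by have := lmin c isT; rewrite eq_sym ac lac => /(_ isT).
  by rewrite !cardsU1 !inE negb_or !lh xpair_eqE eqxx /= (card_in_imset hull_code_inj) addnA addnC.
have card_rest : #|M :\: low| <= #|~: bad|.
  apply: (@leq_card_rel _ _ _ _ charge) => [[u v]|e e' c]; last first.
    by rewrite !inE => /andP[_ eM] /andP[_ e'M]; apply: charge_inj.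
  rewrite !inE => /andP[+ uvM]; rewrite uvM negb_forall => /existsP[w] /=.
  rewrite negb_imply negbK => /andP[wM ouw].
  have [c chc] := charge_exists uvM wM ouw; exists c => //.
  rewrite !inE; apply/negP => /orP[/eqP|/orP[/eqP|/imsetP[[a b] /hull_edgesP[ab H]]]] E; subst c.
  - case: chc => w' [_ _ _ _ /= [E K]].
    by have := lmin w' isT (ot_neq _); rewrite E (ot_asym K) => /(_ K).
  - case: chc => w' [_ _ _ _ /= [E K]].
    by have := lmin u isT (ot_neq _); rewrite E (ot_asym K) => /(_ K).
  - move: chc; rewrite /hull_code /=; case: ifP => lab.
      exact: (charge_not_lower uvM lab H).
    apply: (charge_not_upper uvM _ H).
    by have := ot_total ot ab; rewrite lab.
have lowM : #|M :&: low| = #|low|.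
  by congr #|pred_of_set _|; apply/setIidPr/subsetP => e; rewrite inE => /andP[].
have := cardsID low M; have := cardsC bad; rewrite card_prod card_bool lowM.
lia.
Qed.

End MaxPlane.

(** * Three layers do not suffice for 15 points *)

Section LowerBound.
Variables (V : finType) (lt : rel V) (o : V -> V -> V -> bool).
Hypothesis ot : order_type lt o.
Local Notation crosses := (segments_cross o).
Local Notation maxplane := (maxplane lt o).
Local Notation hull_edges := (hull_edges o).
Local Notation hull a b := ((a, b) \in hull_edges).

Definition edge u v := if lt u v then (u, v) else (v, u).

Lemma edge_lt u v : u != v -> lt (edge u v).1 (edge u v).2.
Proof. by move=> uv; rewrite /edge; case: ifP => //= n; have := ot_total ot uv; rewrite n. Qed.

Lemma edgeC u v : edge u v = edge v u.
Proof.
rewrite /edge; have [->//|uv] := eqVneq u v.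
case: ifP => luv; first by rewrite (ot_asym ot luv).
by case: ifP => // lvu; have := ot_total ot uv; rewrite luv lvu.
Qed.

Lemma edge_eq u v x y :
  (edge u v == edge x y) = (u == x) && (v == y) || (u == y) && (v == x).
Proof.
apply/eqP/orP => [|[/andP[/eqP-> /eqP->]|/andP[/eqP-> /eqP->]]] //; last exact: edgeC.
by rewrite /edge; case: ifP => _; case: ifP => _ [-> ->]; rewrite !eqxx; [left|right|right|left].
Qed.

Lemma crosses_edge u v x y : crosses (edge u v).1 (edge u v).2 x y = crosses u v x y.
Proof. by rewrite /edge; case: ifP => //= _; rewrite (crossesl ot). Qed.

Section Max.
Variable M : {set V * V}.
Hypothesis Mmax : maxplane M.

Lemma edge_max u v : u != v -> edge u v \notin M ->
  exists x y, edge x y \in M /\ crosses u v x y.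
Proof.
move=> uv; rewrite (surjective_pairing (edge u v)) => /(mp_max Mmax (edge_lt uv))[x [y [xyM H]]].
exists x, y; split; first by rewrite /edge (mp_lt Mmax xyM).
by rewrite (crossesC o) crosses_edge in H.
Qed.

Lemma edge_noncross u v x y : edge u v \in M -> edge x y \in M -> ~~ crosses u v x y.
Proof.
move=> H K; rewrite -crosses_edge (crossesC o) -crosses_edge (crossesC o).
by apply: (mp_plane Mmax); rewrite -surjective_pairing.
Qed.

Lemma uncrossed_max u v : u != v -> (forall x y, ~~ crosses u v x y) -> edge u v \in M.
Proof.
move=> uv H; apply/negPn/negP => /(edge_max uv)[x [y [_]]].
by rewrite (negPf (H x y)).
Qed.

End Max.

(** Extends [ear_uncrossed] to segments with an endpoint [b], which lies on the separating line
    itself. *)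
Lemma ear_side a x b p q : o b x a ->
  (p \notin [:: a; x; b] -> o x b p) -> (q \notin [:: a; x; b] -> o x b q) -> ~~ crosses a x p q.
Proof.
move=> obxa hp hq; apply/negP => /andP[U]; apply/negP.
have Ub := ot_uniq ot obxa; duniq U; duniq Ub.
have H c : c != a -> c != x -> c != b -> o x b c -> ~~ cross4 o a x b c.
  move=> ca cx cb oc; have U4 : uniq [:: a; x; b; c] by uniqs.
  by have := ear_uncrossed_end ot U4; rewrite obxa oc.
have [Ep|pb] := eqVneq p b.
  subst p; apply: H; try by rewrite eq_sym.
  by apply: hq; rewrite !inE !negb_or !(eq_sym q); apply/and3P.
have op : o x b p.
  by apply: hp; rewrite !inE !negb_or pb !(eq_sym p) andbT; apply/andP.
have [Eq|qb] := eqVneq q b.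
  subst q; have U' : uniq [:: a; x; b; p] by uniqs.
  have := crossesr ot a x p b; rewrite /segments_cross U U' /= => ->.
  by apply: H => //; rewrite eq_sym.
have oq : o x b q.
  by apply: hq; rewrite !inE !negb_or qb !(eq_sym q) andbT; apply/andP.
have U5 : uniq [:: a; x; b; p; q] by uniqs.
by have := ear_uncrossed ot U5; rewrite obxa op oq.
Qed.

(** * The convex hull and its ears *)

Lemma hull_neq a b : hull a b -> a != b. Proof. by case/hull_edgesP. Qed.

Lemma hullP a b d : hull a b -> d != a -> d != b -> o a b d.
Proof. by case/hull_edgesP=> _; apply. Qed.

Lemma hull_uncrossed a b x y : hull a b -> ~~ crosses a b x y.
Proof.
move=> ab; apply/negP => /andP[U]; rewrite /cross4.
by duniq U; rewrite !(hullP ab) // eq_sym.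
Qed.

Lemma hull_injl a b c : hull a b -> hull c b -> a = c.
Proof.
move=> ab cb; have [//|ac] := eqVneq a c.
have := hullP ab; move=> /(_ c); rewrite (eq_sym c) ac (hull_neq cb) => /(_ isT isT).
by move=> /(o_asym ot); rewrite -(ot_cyc ot) (hullP cb) // hull_neq.
Qed.

(** Gift wrapping: all points lie to the left of [c a], so the angular order round [a] is linear,
    and its first point is [b]. *)
Lemma hull_next c a : hull c a -> exists b, hull a b.
Proof.
move=> ca; have ne := hull_neq ca.
have oca x : x != c -> x != a -> o c a x by apply: hullP.
(* [c] is the last point in this order. *)
have ncx x : o a c x = false.
  apply/negP => H; have := ot_uniq ot H; rewrite /= !inE negb_or => /and3P[/andP[_ ax] cx _].
  by move: H; rewrite (o_asym ot) // oca // eq_sym.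
have [|x y xa ya xy|x y z xa ya za U xy yz|b ba bmin] :=
  @fin_minimum _ (fun x => x != a) (o a).
- by exists c.
- by apply: (o_total_r ot); rewrite /= !inE negb_or !(eq_sym a) xa ya xy.
- have [E|zc] := eqVneq z c.
    rewrite E -(ot_cyc ot) oca //; apply/eqP => E'; move: U.
    by rewrite E E' /= !inE eqxx orbT.
  have xc : x != c by apply: contraTneq xy => ->; rewrite ncx.
  have yc : y != c by apply: contraTneq yz => ->; rewrite ncx.
  have U5 : uniq [:: c; a; x; y; z].
    by move: U; rewrite /= !inE !negb_or !(eq_sym c) !(eq_sym a) ne xc yc zc xa ya za.
  by have := hull_trans ot U5; rewrite !oca //= xy yz.
by exists b; apply/hull_edgesP; split=> [|d da db]; [rewrite eq_sym|apply: bmin].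
Qed.

Lemma hull_first : 1 < #|V| -> exists l b, hull l b.
Proof.
move=> /card_gt1P[x0 [x1 [_ _ x01]]].
have [|x y _ _ xy|x y z _ _ _ _ xy yz|l _ lmin] := @fin_minimum _ predT lt.
- by exists x0.
- exact: (ot_total ot).
- exact: (ot_trans ot xy yz).
have [|x y xl yl xy|x y z xl yl zl U xy yz|b bl bmin] :=
  @fin_minimum _ (fun x => x != l) (o l).
- by have [E|] := eqVneq x0 l; [exists x1; rewrite -E eq_sym|exists x0].
- by apply: (o_total_r ot); rewrite /= !inE negb_or !(eq_sym l) xl yl xy.
- have U4 : uniq [:: l; x; y; z] by rewrite cons_uniq U !inE !negb_or !(eq_sym l) xl yl zl.
  by have := right_trans ot U4; rewrite !lmin // xy yz => /(_ isT).
by exists l, b; apply/hull_edgesP; split=> [|d da db]; [rewrite eq_sym|apply: bmin].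
Qed.

Lemma hull_noback a b : 2 < #|V| -> hull a b -> hull b a -> False.
Proof.
move=> V2 ab ba.
have /card_gt0P[d] : 0 < #|~: [set a; b]|.
  by rewrite cardsCs setCK cards2 subn_gt0; apply: leq_ltn_trans V2; case: (a != b).
rewrite !inE negb_or => /andP[da db].
by have := hullP ba db da; rewrite (o_asym ot) // (hullP ab).
Qed.

(** [x] is the neighbour of [b] on the hull of what remains after deleting [a] and the points of
    [X]. Empty [X] gives the first ear point, the singleton of that point gives the second. *)
Lemma ear_vertex a b (X : pred V) : hull a b ->
    (exists x, [&& x != a, x != b & ~~ X x]) ->
  exists x, [/\ x != a, x != b, ~~ X x &
    forall d, d != a -> d != b -> ~~ X d -> d != x -> o x b d].
Proof.
move=> ab ex; have ne := hull_neq ab.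
have [//|x y /and3P[xa xb _] /and3P[ya yb _] xy
  |x y z /and3P[xa xb _] /and3P[ya yb _] /and3P[za zb _] U xy yz
  |x /and3P[xa xb xX] xmin] :=
  @fin_minimum _ (fun x => [&& x != a, x != b & ~~ X x]) (fun x y => o b y x).
- by apply: (o_total_r ot); rewrite /= !inE negb_or !(eq_sym b) xb yb eq_sym xy.
- have U5 : uniq [:: a; b; z; y; x] by duniq U; uniqs.
  by have := hull_trans ot U5; rewrite !(hullP ab) //= xy yz.
exists x; split => // d da db dX dx.
by rewrite (ot_cyc ot); apply: xmin; rewrite ?da ?db.
Qed.

(** By [ear_side] only segments from [x] can cross [a y], and only segments from [a] can cross
    [x y]. Were both missing, maximality would put [x p] and [a q] into [M], and these cross by
    [two_exits_cross]. *)
Lemma ear_pair M a b x y : maxplane M -> hull a b ->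
    x != a -> x != b -> (forall d, d != a -> d != b -> d != x -> o x b d) ->
    y != a -> y != b -> y != x -> (forall d, d != a -> d != b -> d != x -> d != y -> o y b d) ->
  (edge a y \in M) || (edge x y \in M).
Proof.
move=> Mmax ab xa xb Hx ya yb yx Hy; apply/negPn; rewrite negb_or; apply/negP => /andP[nay nxy].
have obya : o b y a by rewrite -(ot_cyc ot) (hullP ab).
have obyx : o b y x by rewrite -(ot_cyc ot) Hx.
have [p [xpM crp]] : exists p, edge x p \in M /\ crosses a y x p.
  have [|p [q [pqM cr]]] := edge_max Mmax _ nay; first by rewrite eq_sym.
  have [Ep|px] := eqVneq p x; first by exists q; rewrite -Ep.
  have [Eq|qx] := eqVneq q x.
    by exists p; rewrite -Eq edgeC -(crossesr ot).
  move: cr; rewrite (negPf (@ear_side _ _ b _ _ _ _ _)) //; rewrite !inE !negb_or.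
    by move=> /and3P[pa py pb]; apply: Hy.
  by move=> /and3P[qa qy qb]; apply: Hy.
have [q [aqM crq]] : exists q, edge a q \in M /\ crosses x y a q.
  have [|p' [q [pqM cr]]] := edge_max Mmax _ nxy; first by rewrite eq_sym.
  have [Ep|pa] := eqVneq p' a; first by exists q; rewrite -Ep.
  have [Eq|qa] := eqVneq q a.
    by exists p'; rewrite -Eq edgeC -(crossesr ot).
  move: cr; rewrite (negPf (@ear_side _ _ b _ _ _ _ _)) //; rewrite !inE !negb_or.
    by move=> /and3P[px py pb]; apply: Hy.
  by move=> /and3P[qx qy qb]; apply: Hy.
move: crp crq; rewrite !(crossesC _ _ y) => /andP[Up cp] /andP[Uq cq].
have noc := edge_noncross Mmax xpM aqM.
have [E|pq] := eqVneq p q.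
  subst q; duniq Up; have U : uniq [:: a; x; y; p] by duniq Uq; uniqs.
  by have := two_exits_distinct ot U; rewrite cp cq.
duniq Up; duniq Uq; have U : uniq [:: a; x; y; p; q] by uniqs.
have := two_exits_cross ot U; rewrite cp cq /= => cpq.
by move: noc; rewrite /segments_cross cpq andbT; case/negP; uniqs.
Qed.

Lemma exists_notin (s : seq V) : size s < #|V| -> exists d, d \notin s.
Proof.
move=> sV; apply/existsP; rewrite -[X in is_true X]negbK negb_exists; apply/negP => /forallP H.
have : #|V| <= #|s|.
  by rewrite -cardsT; apply/subset_leq_card/subsetP => x _; have := H x; rewrite negbK.
by move=> /leq_trans/(_ (card_size s)); rewrite leqNgt sV.
Qed.

(** The point [d], on the same side of the line [b c] as [a], prevents the ear point [x] from being
    [c]; so [a x] differs from the chord [a c]. *)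
Lemma ear_interior a b c d : hull a b -> d \notin [:: a; b; c] -> o b c d ->
  exists x, [/\ x \notin [:: a; b; c], forall y, y != a -> y != b -> y != x -> o x b y &
     forall p q, ~~ crosses a x p q].
Proof.
move=> ab; rewrite !inE !negb_or => /and3P[da db dc] obcd.
have [|x [xa xb _ H]] := @ear_vertex a b pred0 ab; first by exists d; rewrite da db.
exists x; rewrite !inE !negb_or xa xb; split; last 1 first.
- move=> p q; apply: (@ear_side _ _ b).
  + by rewrite -(ot_cyc ot) (hullP ab).
  + by rewrite !inE !negb_or => /and3P[pa px pb]; apply: H.
  + by rewrite !inE !negb_or => /and3P[pa px pb]; apply: H.
- apply/eqP => E; subst x; have := H d da db isT dc.
  by rewrite (o_asym ot).
- by move=> y ya yb yx; apply: H.
Qed.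

(** A fifth point [d] lies on the inner side of the hull edge [b c], which rules out [y = c]. *)
Lemma triangle_second_ear a b c x : 4 < #|V| -> hull a b -> hull b c -> x \notin [:: a; b; c] ->
  exists y, [/\ y \notin [:: a; b; c; x] &
     forall z, z != a -> z != b -> z != x -> z != y -> o y b z].
Proof.
move=> V4 ab bc; rewrite !inE !negb_or => /and3P[xa xb xc].
have [d] := @exists_notin [:: a; b; c; x] V4.
rewrite !inE !negb_or => /and4P[da db dc dx].
have [|y [ya yb yx H]] := @ear_vertex a b (pred1 x) ab; first by exists d; rewrite da db.
exists y; split; last by move=> z za zb zx zy; apply: H.
rewrite !inE !negb_or ya yb yx andbT; apply/eqP => E; subst y.
by have := H d da db dx dc; rewrite (o_asym ot) // (hullP bc).
Qed.

Definition segments : {set V * V} := [set e | lt e.1 e.2].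

Lemma edge_segment u v : u != v -> edge u v \in segments.
Proof. by rewrite inE; apply: edge_lt. Qed.

Lemma card_segments : 2 * #|segments| = #|V| * #|V|.-1.
Proof.
pose rev := [set e : V * V | lt e.2 e.1].
have card_rev : #|rev| = #|segments|.
  have swI : injective (fun e : V * V => (e.2, e.1)) by move=> [a b] [c d] [-> ->].
  rewrite -(card_imset _ swI); congr #|pred_of_set _|; apply/setP => -[a b].
  rewrite inE /=; apply/imsetP/idP => [[[c d] + [-> ->]]|H]; first by rewrite inE.
  by exists (b, a); rewrite ?inE.
pose diag := [set (x, x) | x : V].
have card_diag : #|diag| = #|V| by rewrite card_imset // => x y [].
have nrev : segments :&: rev = set0.
  apply/setP => -[a b]; rewrite !inE /=; apply/negP => /andP[/(ot_asym ot) ->] //.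
have ndiag : segments :|: rev = ~: diag.
  apply/setP => -[a b]; rewrite in_setU in_setC !inE /=; apply/idP/idP => H.
    by apply/negP => /imsetP[x _ [E E']]; move: H; rewrite E E' (ot_irr ot).
  by apply: (ot_total ot); apply: contra H => /eqP->; apply: imset_f.
have := cardsU segments rev; rewrite nrev ndiag cards0 card_rev => H.
have := cardsC diag; rewrite card_diag card_prod H; nia.
Qed.

(** * Counting segments with multiplicity *)

Section Count.
Variables (M : 'I_3 -> {set V * V}) (U F : {set V * V}).
Hypothesis M_seg : forall i, M i \subset segments.
Hypothesis M_cover : forall e, e \in segments -> exists i, e \in M i.
Hypothesis U_seg : U \subset segments.
Hypothesis F_seg : F \subset segments.
Hypothesis UF : [disjoint U & F].
Hypothesis U_all : forall e i, e \in U -> e \in M i.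
Hypothesis F_two : forall e, e \in F -> 1 < \sum_(i < 3) (e \in M i).

(** Double counting: a segment contributes 3 if it is in [U], at least 2 if in [F], and at least 1
    otherwise. *)
Lemma count_segments : #|segments| + 2 * #|U| + #|F| <= \sum_(i < 3) #|M i|.
Proof.
have cardE (A : {set V * V}) : A \subset segments -> #|A| = \sum_(e in segments) (e \in A).
  move=> /subsetP sA; rewrite -sum1_card.
  rewrite (eq_bigl (fun e => (e \in segments) && (e \in A))); last first.
    by move=> e; have [/sA ->|_] := boolP (e \in A); rewrite ?andbF.
  by rewrite big_mkcondr; apply: eq_bigr => e _; case: (e \in A).
rewrite (cardE U) // (cardE F) // -sum1_card big_distrr /= -!big_split /=.
have -> : \sum_(i < 3) #|M i| = \sum_(e in segments) \sum_(i < 3) (e \in M i).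
  by rewrite exchange_big; apply: eq_bigr => i _; apply: cardE.
apply: leq_sum => e eS.
have [eU|eU] := boolP (e \in U).
  have -> : (e \in F) = false by exact: (disjointFr UF eU).
  by rewrite !big_ord_recr big_ord0 /= !U_all.
have [eF|eF] := boolP (e \in F); first exact: F_two.
have [i ei] := M_cover eS.
by rewrite (bigD1 i) //= ei.
Qed.

End Count.

Ltac ne2 := try solve [assumption | by rewrite eq_sym].

Theorem no_three_layers (col : V -> V -> 'I_3) :
    (forall u v x y, lt u v -> lt x y -> col u v = col x y -> ~~ crosses u v x y) ->
  #|V| = 15 -> False.
Proof.
move=> col_plane V15.
(* Each colour class is enlarged to a maximal plane set; these sets may overlap, which is what the
   count exploits. *)
have [M MP] : exists M : 'I_3 -> {set V * V}, forall i, maxplane (M i) /\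
    [set e | lt e.1 e.2 & col e.1 e.2 == i] \subset M i.
  apply: (@fin_all_exists _ (fun=> {set V * V}) (fun i X => maxplane X /\
    [set e | lt e.1 e.2 & col e.1 e.2 == i] \subset X)) => i.
  have [||X] := @maxplane_exists _ lt o [set e | lt e.1 e.2 & col e.1 e.2 == i].
  - by move=> u v; rewrite inE => /andP[].
  - move=> u v x y; rewrite !inE /= => /andP[uv /eqP E] /andP[xy /eqP E'].
    by apply: col_plane; rewrite ?E ?E'.
  - by exists X.
have M_max i : maxplane (M i) by case: (MP i).
have M_seg i : M i \subset segments.
  by apply/subsetP => -[u v] /(mp_lt (M_max i)) uv; rewrite inE.
have M_cover e : e \in segments -> exists i, e \in M i.
  rewrite inE => eL; exists (col e.1 e.2); apply: (subsetP (MP _).2).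
  by rewrite inE eL eqxx.
have seg : #|segments| = 105 by have := card_segments; rewrite V15; lia.
(* Three times [card_maxplane]: [126 = 3 * (3 * 15 - 3)]. *)
have bound k : k <= #|hull_edges| -> \sum_(i < 3) #|M i| + 3 * k <= 126.
  move=> hk; have V0 : 0 < #|V| by rewrite V15.
  have : \sum_(i < 3) (#|M i| + #|hull_edges| + 3) <= \sum_(i < 3) (3 * #|V|).
    by apply: leq_sum => i _; apply: (card_maxplane ot (M_max i)).
  rewrite !big_split /= !sum_nat_const card_ord V15.
  by move: hk; set h := #|_|; set S := \sum_(i < 3) _ => hk H; lia.
(* Each case below ends by violating this inequality with uncrossed segments [U], segments [F] lying
   in two layers, and [k] hull edges. *)
have total (U F : seq (V * V)) k : uniq (U ++ F) -> {subset U ++ F <= segments} ->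
    (forall e i, e \in U -> e \in M i) ->
    (forall e, e \in F -> 1 < \sum_(i < 3) (e \in M i)) -> k <= #|hull_edges| ->
    105 + 2 * size U + size F + 3 * k <= 126.
  rewrite cat_uniq => /and3P[uU UF uF] sub HU HF /bound.
  have := @count_segments M [set e in U] [set e in F] M_seg M_cover.
  have -> : #|[set e in U]| = size U by rewrite cardsE; apply/card_uniqP.
  have -> : #|[set e in F]| = size F by rewrite cardsE; apply/card_uniqP.
  rewrite seg; set S := \sum_(i < 3) #|M i| => H B.
  suff : 105 + 2 * size U + size F <= S by lia.
  apply: H.
  - by apply/subsetP => e; rewrite inE => eU; apply: sub; rewrite mem_cat eU.
  - by apply/subsetP => e; rewrite inE => eF; apply: sub; rewrite mem_cat eF orbT.
  - rewrite disjoints_subset; apply/subsetP => e; rewrite !inE => eU.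
    by apply: contra UF => eF; apply/hasP; exists e.
  - by move=> e i; rewrite inE; apply: HU.
  - by move=> e; rewrite inE; apply: HF.
have uncM u v i : u != v -> (forall x y, ~~ crosses u v x y) -> edge u v \in M i.
  by move=> uv H; apply: uncrossed_max.
have hullM u v i : hull u v -> edge u v \in M i.
  by move=> uv; apply: uncM (hull_neq uv) _ => x y; apply: hull_uncrossed.
have hull_card (s : seq (V * V)) : uniq s -> {subset s <= hull_edges} -> size s <= #|hull_edges|.
  move=> us sub; rewrite -(card_uniqP us); apply/subset_leq_card/subsetP => e; exact: sub.
have noback a b : hull a b -> hull b a -> False by apply: hull_noback; rewrite V15.
have [a [b hab]] : exists l b, hull l b by apply: hull_first; rewrite V15.
have [c hbc] := hull_next hab.
have [d hcd] := hull_next hbc.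
have ab := hull_neq hab; have bc := hull_neq hbc; have cd := hull_neq hcd.
have ac : a != c by apply/eqP => E; apply: (noback a b) => //; rewrite E.
have bd : b != d by apply/eqP => E; apply: (noback b c) => //; rewrite E.
have S (x y : V) : x != y -> (y == x) = false by rewrite eq_sym => /negPf.
(* First case: the hull is the triangle [a b c]. *)
have [ad|ad] := eqVneq a d.
  subst d.
  have ear x y z : hull x y -> hull y z -> exists x1,
      [/\ x1 \notin [:: x; y; z], forall d, d != x -> d != y -> d != x1 -> o x1 y d &
        forall p q, ~~ crosses x x1 p q].
    move=> xy yz; have [|d dn] := @exists_notin [:: x; y; z]; first by rewrite V15.
    apply: (ear_interior xy dn); move: dn; rewrite !inE !negb_or => /and3P[_ dy dz].
    by rewrite (hullP yz).
  have [a1 [a1n a1P a1u]] := ear _ _ _ hab hbc.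
  have [b1 [b1n b1P b1u]] := ear _ _ _ hbc hcd.
  have [c1 [c1n c1P c1u]] := ear _ _ _ hcd hab.
  move: (c1n) (b1n) (a1n); rewrite !inE !negb_or => /and3P[c1c c1a c1b] /and3P[b1b b1c b1a] /and3P[a1a a1b a1c].
  have [|a2 [+ a2P]] := triangle_second_ear _ hab hbc a1n; first by rewrite V15.
  rewrite !inE !negb_or => /and4P[a2a a2b a2c a2a1].
  have pair i : (edge a a2 \in M i) || (edge a1 a2 \in M i).
    exact: (ear_pair (M_max i) hab).
  (* Every layer contains one of the two segments of [pair]; with three layers, one of them occurs
     twice. *)
  have [f fP f2] : exists2 f, (f == edge a a2) || (f == edge a1 a2) & 1 < \sum_(i < 3) (f \in M i).
    suff /orP[H|H] : (1 < \sum_(i < 3) (edge a a2 \in M i)) || (1 < \sum_(i < 3) (edge a1 a2 \in M i)).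
    - by exists (edge a a2); rewrite ?eqxx.
    - by exists (edge a1 a2); rewrite ?eqxx ?orbT.
    have : \sum_(i < 3) 1 <= \sum_(i < 3) ((edge a a2 \in M i) + (edge a1 a2 \in M i)).
      by apply: leq_sum => i _; have := pair i; case: (_ \in _) => //= ->.
    rewrite big_split sum_nat_const card_ord /=.
    by move: (\sum_(i < 3) _) (\sum_(i < 3) _) => x y; clear; lia.
  (* [105 + 2 * 6 + 1 + 3 * 3 = 127]. *)
  have this := total [:: edge a b; edge b c; edge c a; edge a a1; edge b b1; edge c c1] [:: f] 3.
  have N := (negPf ab, negPf bc, negPf cd, negPf ac, negPf a1a, negPf a1b, negPf a1c,
    negPf b1a, negPf b1b, negPf b1c, negPf c1a, negPf c1b, negPf c1c,
    negPf a2a, negPf a2b, negPf a2c, negPf a2a1).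
  have N' := (S _ _ ab, S _ _ bc, S _ _ cd, S _ _ ac, S _ _ a1a, S _ _ a1b, S _ _ a1c, S _ _ b1a, S _ _ b1b, S _ _ b1c, S _ _ c1a, S _ _ c1b, S _ _ c1c,
    S _ _ a2a, S _ _ a2b, S _ _ a2c, S _ _ a2a1).
  have fU e : e \in [:: edge a b; edge b c; edge c a; edge a a1; edge b b1; edge c c1] -> f != e.
    rewrite !inE; case/orP: fP => /eqP->; 
      move=> He; repeat (case/orP: He => [/eqP->|He]; first by rewrite edge_eq !(N, N') ?andbF);
      by rewrite (eqP He) edge_eq !(N, N') ?andbF.
  have U : uniq ([:: edge a b; edge b c; edge c a; edge a a1; edge b b1; edge c c1] ++ [:: f]).
    rewrite cats1 rcons_uniq; apply/andP; split; first by apply/negP => /fU; rewrite eqxx.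
    by rewrite /= !inE !edge_eq !(N, N') ?andbF.
  suff : false by [].
  apply: (this U).
  - apply/allP; rewrite all_cat /= !edge_segment ?N ?N' //.
    by rewrite !andbT; case/orP: fP => /eqP->; rewrite edge_segment ?N ?N'.
  - move=> e i; move: e; apply/allP => /=.
    by rewrite (hullM a b) // (hullM b c) // (hullM c a) // (uncM a a1) ?(uncM b b1) ?(uncM c c1) ?N'.
  - by move=> e; rewrite inE => /eqP->.
  - by apply: (hull_card [:: (a, b); (b, c); (c, a)]);
      [rewrite /= !inE !xpair_eqE !(N, N')|apply/allP; rewrite /= hab hbc hcd].
have [e hde] := hull_next hcd.
have de := hull_neq hde.
have ce : c != e by apply/eqP => E; apply: (noback c d) => //; rewrite E.
have N := (negPf ab, negPf bc, negPf cd, negPf ac, negPf bd, negPf ad).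
have N' := (S _ _ ab, S _ _ bc, S _ _ cd, S _ _ ac, S _ _ bd, S _ _ ad).
have h4 : 4 <= #|hull_edges|.
  apply: (hull_card [:: (a, b); (b, c); (c, d); (d, e)]).
    by rewrite /= !inE !xpair_eqE !(N, N').
  by apply/allP; rewrite /= hab hbc hcd hde.
(* A fifth uncrossed segment is enough: [105 + 2 * 5 + 3 * 4 = 127]. *)
suff [u [v [uv unc_uv new]]] : exists u v, [/\ u != v, forall x y, ~~ crosses u v x y &
    edge u v \notin [:: edge a b; edge b c; edge c d; edge d e]].
  suff : false by [].
  apply: (total [:: edge u v; edge a b; edge b c; edge c d; edge d e] [::] 4) => //.
  - by rewrite cats0 /= new !inE !edge_eq !(N, N') (negPf ce) ?andbF.
  - by apply/allP; rewrite /= !edge_segment.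
  - move=> x i; move: x; apply/allP => /=.
    by rewrite (uncM u v) // (hullM a b) // (hullM b c) // (hullM c d) // (hullM d e).
(* If the hull has more than four vertices, the next hull edge [e g] serves. *)
have [ea|ea] := eqVneq e a; last first.
  have [g heg] := hull_next hde.
  exists e, g; split; [exact: hull_neq|by move=> x y; apply: hull_uncrossed|].
  have eb : e != b.
    by apply/eqP => E; move: hde; rewrite E => /hull_injl/(_ hab) E'; rewrite E' eqxx in ad.
  have gd : g != d by apply/eqP => E; apply: (noback d e) => //; rewrite -E.
  rewrite !inE !edge_eq (negPf ea) (negPf eb) (negPf gd) (S _ _ ce) (S _ _ de).
  by rewrite ?andbF.
subst e.
have [|x xn] := @exists_notin [:: a; b; c; d]; first by rewrite V15.
move: xn; rewrite !inE !negb_or => /and4P[xa xb xc xd].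
(* The diagonal [c a] cuts the hull quadrilateral into the ears at [b] and at [d]; [x] lies in one
   of them. *)
have /orP[oca|oac] : o c a x || o a c x.
  by apply: (o_total ot); rewrite uniq3E (S _ _ ac) (eq_sym c) xc (eq_sym a) xa.
- have [|y [yn _ yu]] := @ear_interior b c a x hbc _ oca.
    by rewrite !inE !negb_or xa xb xc.
  move: yn; rewrite !inE !negb_or => /and3P[yb yc ya].
  exists b, y; split => //; first by rewrite eq_sym.
  by rewrite !inE !edge_eq !(N, N') (negPf ya) (negPf yc) ?andbF.
- have [|y [yn _ yu]] := @ear_interior d a c x hde _ oac.
    by rewrite !inE !negb_or xa xd xc.
  move: yn; rewrite !inE !negb_or => /and3P[yd ya yc].
  exists d, y; split => //; first by rewrite eq_sym.
  by rewrite !inE !edge_eq !(N, N') (negPf ya) (negPf yc) ?andbF.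
Qed.

End LowerBound.

(** * Order types of points in the plane *)

Import Order.TTheory GRing.Theory Num.Theory.
Local Open Scope ring_scope.

Section Plane.
Variable R : realFieldType.
Implicit Types p q r u v w x y z : R * R.

Definition det p q r : R := (q.1 - p.1) * (r.2 - p.2) - (q.2 - p.2) * (r.1 - p.1).

Definition lexlt p q : bool := (p.1 < q.1) || (p.1 == q.1) && (p.2 < q.2).

Lemma det_cyc p q r : det p q r = det q r p. Proof. by rewrite /det; ring. Qed.
Lemma det_swap p q r : det q p r = - det p q r. Proof. by rewrite /det; ring. Qed.

Lemma det_seg p q x y t : det p q ((1 - t) * x.1 + t * y.1, (1 - t) * x.2 + t * y.2) =
  (1 - t) * det p q x + t * det p q y.
Proof. by rewrite /det /=; ring. Qed.

Lemma lexlt_trans : transitive lexlt.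
Proof.
move=> y x z; rewrite /lexlt => /orP[xy|/andP[/eqP-> xy]] /orP[yz|/andP[/eqP<- yz]].
- by rewrite (lt_trans xy yz).
- by rewrite xy.
- by rewrite yz.
- by rewrite eqxx (lt_trans xy yz) orbT.
Qed.

Definition wedge u v : R := u.1 * v.2 - u.2 * v.1.
Definition lexpos u : bool := (0 < u.1) || (u.1 == 0) && (0 < u.2).

(** In [wedge u w * v = wedge v w * u + wedge u v * w] the right side has positive coefficients. If
    [wedge u w <= 0], comparing first coordinates makes [u] and [w] vertical, and the second
    coordinates then give a contradiction. *)
Lemma wedge_trans u v w : lexpos u -> lexpos v -> lexpos w ->
  0 < wedge u v -> 0 < wedge v w -> 0 < wedge u w.
Proof.
move=> pu pv pw uv vw; rewrite ltNge; apply/negP => uw.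
have E1 : wedge u w * v.1 = wedge v w * u.1 + wedge u v * w.1 by rewrite /wedge; ring.
have E2 : wedge u w * v.2 = wedge v w * u.2 + wedge u v * w.2 by rewrite /wedge; ring.
have nn x : lexpos x -> 0 <= x.1 by case/orP => [/ltW|/andP[/eqP->]].
have l1 : wedge u w * v.1 <= 0 by apply: mulr_le0_ge0 => //; apply: nn.
have r1 : 0 <= wedge v w * u.1 by apply: mulr_ge0; [apply: ltW|apply: nn].
have r2 : 0 <= wedge u v * w.1 by apply: mulr_ge0; [apply: ltW|apply: nn].
have u1 : wedge v w * u.1 = 0 by lra.
have w1 : wedge u v * w.1 = 0 by lra.
have c1 : wedge u w * v.1 = 0 by lra.
move/eqP: u1; rewrite mulf_eq0 gt_eqF //= => /eqP u1.
move/eqP: w1; rewrite mulf_eq0 gt_eqF //= => /eqP w1.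
move: pu pw; rewrite /lexpos u1 w1 ltxx eqxx /= => u2 w2.
have c2 : 0 < wedge v w * u.2 by apply: mulr_gt0.
have c3 : 0 < wedge u v * w.2 by apply: mulr_gt0.
move/eqP: c1; rewrite mulf_eq0 => /orP[/eqP c0|/eqP v1].
  by move: E2; rewrite c0 mul0r; lra.
by move: uv; rewrite /wedge u1 v1 mul0r mulr0 subrr ltxx.
Qed.

Lemma wedge_anti u v : wedge v u = - wedge u v. Proof. by rewrite /wedge; ring. Qed.

Lemma lexlt_pos p q : lexlt p q -> lexpos (q.1 - p.1, q.2 - p.2).
Proof. by rewrite /lexlt /lexpos /= !subr_gt0 subr_eq0 (eq_sym q.1). Qed.

(** For successive differences [x], [y], [z] the determinants are [s], [s + t], [t + r], [r]. If [s]
    and [r] have the same sign, [wedge_trans] passes it to [t]; otherwise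
    [(s + t) - (t + r) = s - r] leaves only one change of sign. *)
Lemma det_mono a b c d : lexlt a b -> lexlt b c -> lexlt c d ->
    det a b c != 0 -> det a b d != 0 -> det a c d != 0 -> det b c d != 0 ->
  mono4 (0 < det a b c) (0 < det a b d) (0 < det a c d) (0 < det b c d).
Proof.
move=> /lexlt_pos; set x := (_, _) => px /lexlt_pos; set y := (_, _) => py.
move=> /lexlt_pos; set z := (_, _) => pz.
have -> : det a b c = wedge x y by rewrite /det /wedge /x /y /=; ring.
have -> : det a b d = wedge x y + wedge x z by rewrite /det /wedge /x /y /z /=; ring.
have -> : det a c d = wedge x z + wedge y z by rewrite /det /wedge /x /y /z /=; ring.
have -> : det b c d = wedge y z by rewrite /det /wedge /x /y /z /=; ring.
have tp := wedge_trans px py pz; have tn := wedge_trans pz py px.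
move: tp tn; rewrite (wedge_anti x z) (wedge_anti y z) (wedge_anti x y) !oppr_gt0.
move: (wedge x y) (wedge x z) (wedge y z) => s t r tp tn s0 st tr r0.
case: (ltrgtP 0 s) s0 => // s0 _; case: (ltrgtP 0 r) r0 => // r0 _.
- have := tp s0 r0 => t0.
  by rewrite !addr_gt0.
- case: (ltrgtP 0 (s + t)) st => // h _; case: (ltrgtP 0 (t + r)) tr => // k _; exfalso; lra.
- case: (ltrgtP 0 (s + t)) st => // h _; case: (ltrgtP 0 (t + r)) tr => // k _; exfalso; lra.
- have := tn r0 s0 => t0.
  have -> : 0 < s + t = false by apply/negP; lra.
  by have -> : 0 < t + r = false by apply/negP; lra.
Qed.

(** With [r = (1 - t) p + t q], the cases are [t < 0], [t > 1] and the rest; solving for [p] or [q]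
    gives the parameters [- t / (1 - t)] and [t^-1]. *)
Lemma det0_on_seg p q r : p != q -> det p q r = 0 -> [\/ on_seg p q r, on_seg r q p | on_seg p r q].
Proof.
move=> pq d0.
have [t [E1 E2]] : exists t, r.1 = (1 - t) * p.1 + t * q.1 /\ r.2 = (1 - t) * p.2 + t * q.2.
  have [E|ne] := eqVneq (q.1 - p.1) 0.
    have ne : q.2 - p.2 != 0.
      move: pq; rewrite (surjective_pairing p) (surjective_pairing q) xpair_eqE /=.
      by move/eqP: E; rewrite !subr_eq0 eq_sym => -> /=; rewrite eq_sym.
    exists ((r.2 - p.2) / (q.2 - p.2)); split; last by field.
    have : (q.2 - p.2) * (r.1 - p.1) = 0 by move: d0; rewrite /det E; lra.
    move/eqP; rewrite mulf_eq0 (negPf ne) /= => /eqP; move: E; nra.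
  exists ((r.1 - p.1) / (q.1 - p.1)); split; first by field.
  have : (q.1 - p.1) * (r.2 - p.2) = (q.2 - p.2) * (r.1 - p.1) by move: d0; rewrite /det; lra.
  move=> H; apply: (mulfI ne); move: H => H.
  transitivity ((q.1 - p.1) * p.2 + (q.1 - p.1) * (r.2 - p.2)); first by ring.
  by rewrite H; field.
have [t0|t0] := ltP t 0.
  apply: Or32; exists (- t / (1 - t)).
    rewrite divr_ge0 ?ler_pdivrMr ?mul1r; lra.
  rewrite [LHS]surjective_pairing E1 E2; congr pair; field; lra.
have [t1|t1] := ltP 1 t.
  apply: Or33; exists (t^-1).
    by rewrite invr_ge0 t0 invf_le1 ?ltW //; lra.
  rewrite [LHS]surjective_pairing E1 E2; congr pair; field; lra.
by apply: Or31; exists t; rewrite ?t0 // [LHS]surjective_pairing E1 E2.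
Qed.

(** Along [x y] the affine function [det u v] changes sign and vanishes at parameter [s]; the same
    formula on [u v] gives the same point. *)
Lemma cross_on_seg u v x y : det u v x * det u v y < 0 -> det x y u * det x y v < 0 ->
  exists2 z, on_seg u v z & on_seg x y z.
Proof.
move=> H K.
have bw (a b : R) : a * b < 0 -> (a - b != 0) /\ 0 <= a / (a - b) <= 1.
  move=> ab; case: (ltrgtP a 0) => a0; last by move: ab; rewrite a0 mul0r ltxx.
    have b0 : 0 < b by move: ab; rewrite nmulr_rlt0.
    split; first by lra.
    by rewrite -mulrNN -invrN divr_ge0 ?ler_pdivrMr ?mul1r; lra.
  have b0 : b < 0 by move: ab; rewrite pmulr_rlt0.
  by split; [lra|rewrite divr_ge0 ?ler_pdivrMr ?mul1r; lra].
have [h1 h2] := bw _ _ H; have [k1 k2] := bw _ _ K.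
have E : det x y u - det x y v = - (det u v x - det u v y) by rewrite /det; ring.
set s := det u v x / _ in h2; set t := det x y u / _ in k2.
exists ((1 - s) * x.1 + s * y.1, (1 - s) * x.2 + s * y.2); last by exists s.
exists t => //; rewrite /s /t E.
by move: h1; rewrite /det => h1; congr pair; field.
Qed.

End Plane.

(** * From drawings to order types and back *)

Section Drawings.
Variable R : realFieldType.

Lemma order_type_det (V : finType) (pos : V -> R * R) : injective pos ->
    (forall u v w, uniq [:: u; v; w] -> det (pos u) (pos v) (pos w) != 0) ->
  order_type (fun u v => lexlt (pos u) (pos v)) (fun u v w => 0 < det (pos u) (pos v) (pos w)).
Proof.
move=> pos_inj gen.
have ltne a b : lexlt (pos a) (pos b) -> a != b.
  by apply: contraTneq => ->; rewrite /lexlt !ltxx andbF.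
split.
- by move=> u; rewrite /lexlt !ltxx andbF.
- by move=> v u w; apply: lexlt_trans.
- move=> u v uv; rewrite /lexlt (eq_sym (pos v).1).
  case: (ltgtP (pos u).1 (pos v).1) => //= E1.
  case: (ltgtP (pos u).2 (pos v).2) => //= E2.
  by case/eqP: uv; apply: pos_inj; rewrite [LHS]surjective_pairing E1 E2 -surjective_pairing.
- move=> u v w; rewrite uniq3E; apply: contraTT.
  rewrite !negb_and !negbK => /or3P[] /eqP->; rewrite -leNgt le_eqVlt; apply/orP; left;
    apply/eqP; rewrite /det; ring.
- by move=> u v w; rewrite det_cyc.
- move=> u v w U; rewrite det_swap oppr_gt0 -leNgt le_eqVlt.
  by rewrite (negPf (gen _ _ _ U)).
- move=> a b c d ab bc cd.
  have ac := lexlt_trans ab bc; have bd := lexlt_trans bc cd; have ad := lexlt_trans ab bd.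
  by apply: det_mono => //; apply: gen; rewrite uniq3E !ltne.
Qed.

Lemma complete_thickness_lower k : geom_drawable R (complete_graph 15) k -> (4 <= k)%N.
Proof.
move=> [pos [layer [pos_inj layer_sym free plane]]]; rewrite leqNgt; apply/negP => k4.
(* Every pair is an edge, so three collinear points would put a vertex on an edge. *)
have gen u v w : uniq [:: u; v; w] -> det (pos u) (pos v) (pos w) != 0.
  rewrite uniq3E => /and3P[uv uw vw]; apply/eqP => d0.
  have puv : pos u != pos v by rewrite (inj_eq pos_inj).
  have [] := det0_on_seg puv d0; apply: free; rewrite /complete_graph ?(eq_sym w) //;
    by apply/eqP; rewrite // eq_sym.
have ot := order_type_det pos_inj gen.
have k3 : (k <= 3)%N by [].
apply: (no_three_layers ot (col := fun u v => widen_ord k3 (layer u v))); last by rewrite card_ord.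
move=> u v x y uv xy /(congr1 val) /= /val_inj E; apply/negP => /andP[U].
duniq U; rewrite /cross4.
have opp (a b : R) : a != 0 -> b != 0 -> (0 < a) != (0 < b) -> a * b < 0.
  by case: (ltrgtP 0 a) => // a0 _; case: (ltrgtP 0 b) => // b0 _ _; nra.
move=> /andP[H K].
have [||z zuv zxy] := @cross_on_seg _ (pos u) (pos v) (pos x) (pos y).
- by apply: opp H; apply: gen; uniqs.
- by apply: opp K; apply: gen; uniqs.
have nsame : ~ same_edge u v x y.
  by case=> -[E1 _]; [move: ne0|move: ne2]; rewrite E1 eqxx.
(* The crossing point would have to be a common endpoint of two segments without one. *)
have [w [uvw xyw] _] := plane u v x y ne ne4 nsame E z zuv zxy.
by case: uvw xyw => -> [] E1; move: ne0 ne1 ne2 ne3; rewrite E1 eqxx.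
Qed.

(** Multiplied by [a], this is a convex combination of the positive numbers [a * a] and [a * b]. *)
Lemma convex_neq0 (a b t : R) : 0 < a * b -> 0 <= t <= 1 -> (1 - t) * a + t * b != 0.
Proof.
move=> ab /andP[t0 t1]; apply/eqP => E.
have : (1 - t) * (a * a) + t * (a * b) = 0 by rewrite -[RHS](mulr0 a) -E; ring.
have a2 : 0 < a * a by rewrite -expr2 exprn_even_gt0 //=; apply: contraTneq ab => ->; rewrite mul0r ltxx.
have h1 : 0 <= (1 - t) * (a * a) by apply: mulr_ge0; lra.
have h2 : 0 <= t * (a * b) by apply: mulr_ge0; lra.
move=> S; have /eqP : t * (a * b) = 0 by lra.
rewrite mulf_eq0 (gt_eqF ab) orbF => /eqP t00.
by move: S; rewrite t00 subr0 mul1r mul0r addr0 => S; rewrite S ltxx in a2.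
Qed.

(** Segments with four distinct ends are disjoint once one line has both ends of the other segment
    strictly on one side; segments with a common end meet only there by general position. *)
Lemma drawing_criterion (V : finType) k (pos : V -> R * R) (layer : V -> V -> 'I_k) :
    (forall u v, layer u v = layer v u) ->
    (forall u v w, uniq [:: u; v; w] -> det (pos u) (pos v) (pos w) != 0) ->
    (forall u v x y, uniq [:: u; v; x; y] -> layer u v = layer x y ->
      0 < det (pos u) (pos v) (pos x) * det (pos u) (pos v) (pos y) \/
      0 < det (pos x) (pos y) (pos u) * det (pos x) (pos y) (pos v)) ->
    injective pos ->
  geometric_drawing (fun u v => u != v) pos layer.
Proof.
move=> lsym gen sep pos_inj.
have shared u v y z : u != v -> u != y -> v != y ->
    on_seg (pos u) (pos v) z -> on_seg (pos u) (pos y) z -> z = pos u.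
  move=> uv uy vy [s _ Es] [t _ Et].
  have d0 a b : det a b a = 0 by rewrite /det; ring.
  have d1 a b : det a b b = 0 by rewrite /det; ring.
  have : det (pos u) (pos v) z = 0 by rewrite Es det_seg d0 d1; ring.
  rewrite Et det_seg d0 mulr0 add0r => /eqP; rewrite mulf_eq0 (negPf (gen _ _ _ _)).
    by rewrite orbF => /eqP ->; rewrite subr0 !mul1r !mul0r !addr0 -surjective_pairing.
  by rewrite uniq3E uv uy vy.
have segC p q z : on_seg p q z -> on_seg q p z.
  move=> [t /andP[t0 t1] ->]; exists (1 - t); first by apply/andP; split; lra.
  by congr pair; ring.
have apart u v x y z : 0 < det (pos u) (pos v) (pos x) * det (pos u) (pos v) (pos y) ->
    on_seg (pos u) (pos v) z -> on_seg (pos x) (pos y) z -> False.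
  move=> H [s _ Es] [t /andP[t0 t1] Et].
  have d0 a b : det a b a = 0 by rewrite /det; ring.
  have d1 a b : det a b b = 0 by rewrite /det; ring.
  have : det (pos u) (pos v) z = 0 by rewrite Es det_seg d0 d1; ring.
  by rewrite Et det_seg => /eqP; apply/negP; apply: convex_neq0; rewrite ?t0.
split => // [u v w uv wu wv [t _ E]|u v x y uv xy nsame same z zuv zxy].
  have := gen u v w; rewrite uniq3E uv /= !(eq_sym _ w); move/eqP: wu => ->; move/eqP: wv => -> /(_ isT).
  by rewrite E det_seg /det; case/eqP; ring.
have [E|ux] := eqVneq u x.
  subst x; exists u; first by auto.
  apply: (shared u v y z) => //; apply/eqP => E; apply: nsame; rewrite E; by left.
have [E|uy] := eqVneq u y.
  subst y; exists u; first by auto.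
  apply: (shared u v x z) => //; [|by apply: segC].
  apply/eqP => E; apply: nsame; rewrite E; by right.
have [E|vx] := eqVneq v x.
  subst x; exists v; first by auto.
  by apply: (shared v u y z) => //; [rewrite eq_sym|apply: segC].
have [E|vy] := eqVneq v y.
  subst y; exists v; first by auto.
  by apply: (shared v u x z) => //; [rewrite eq_sym|apply: segC|apply: segC].
have U : uniq [:: u; v; x; y] by rewrite uniq4E uv ux uy vx vy xy.
case: (sep _ _ _ _ U same) => H; first by case: (apart _ _ _ _ _ H zuv zxy).
by case: (apart _ _ _ _ _ H zxy zuv).
Qed.

End Drawings.

(** * A drawing with four layers *)

Section Rings.
Local Open Scope Z_scope.

(** A rounded regular octagon of radius 200, then a heptagon of radius about 10 round a point near
    [(-5, 10)], both counterclockwise. *)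
Definition rings : seq (Z * Z) :=
  [:: (200, 0); (141, 141); (0, 200); (-141, 141); (-200, 0); (-141, -141); (0, -200); (141, -141);
      (6, 7); (4, 15); (-2, 19); (-10, 17); (-14, 11); (-13, 4); (-6, -1)].

Definition ring_pt (i : nat) : Z * Z := nth (0, 0) rings i.

(** Within a ring, two consecutive index sums modulo 8 form a zigzag; the inner indices 8 to 14
    behave like an octagon with one vertex left out. The diameter from [i] to [i + 4] has sum
    [2 * i + 4], hence layer [i + 2] modulo 4: this is the shift [.+2] for segments between the
    rings. *)
Definition ring_layer (u v : nat) : nat :=
  if ((u < 8) == (v < 8))%N then (((u + v) %% 8)./2)%N else ((minn u v).+2 %% 4)%N.

(** Over binary integers the finite checks can be evaluated; [det_embed] carries the signs over to
    [R]. *)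
Definition detZ (p q r : Z * Z) : Z :=
  ((q.1 - p.1) * (r.2 - p.2) - (q.2 - p.2) * (r.1 - p.1)).

Definition ring_det (i j k : nat) : Z := detZ (ring_pt i) (ring_pt j) (ring_pt k).

Definition general_position : bool :=
  all (fun u => all (fun v => all (fun w =>
    uniq [:: u; v; w] ==> ~~ Z.eqb (ring_det u v w) 0) (iota 0%N 15%N)) (iota 0%N 15%N)) (iota 0%N 15%N).

Definition layers_plane : bool :=
  all (fun u => all (fun v => all (fun x => all (fun y =>
    uniq [:: u; v; x; y] ==> (ring_layer u v == ring_layer x y) ==>
      (Z.ltb 0 (ring_det u v x * ring_det u v y) || Z.ltb 0 (ring_det x y u * ring_det x y v)))
   (iota 0%N 15%N)) (iota 0%N 15%N)) (iota 0%N 15%N)) (iota 0%N 15%N).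

End Rings.

Lemma ring_general_position : general_position. Proof. by vm_compute. Qed.
Lemma ring_layers_plane : layers_plane. Proof. by vm_compute. Qed.

(** * Transfer of the integer drawing to an ordered field *)

Section Embedding.
Variable R : realFieldType.

Definition ZtoR (z : Z) : R := (int_of_Z z)%:~R.

Lemma ZtoR_eq0 z : (ZtoR z == 0) = Z.eqb z Z0.
Proof. by rewrite intr_eq0; case: z => //= p; apply/eqP; lia. Qed.

Lemma ZtoR_gt0 z : (0 < ZtoR z) = Z.ltb Z0 z.
Proof. by rewrite ltr0z; case: z => //= p; rewrite ltz_nat; lia. Qed.

Definition embed (p : Z * Z) : R * R := (ZtoR p.1, ZtoR p.2).

Lemma ZtoRB x y : ZtoR (Z.sub x y) = ZtoR x - ZtoR y.
Proof. by rewrite /ZtoR -[Z.sub x y]/(x - y) !rmorphB. Qed.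

Lemma ZtoRM x y : ZtoR (Z.mul x y) = ZtoR x * ZtoR y.
Proof. by rewrite /ZtoR -[Z.mul x y]/(x * y) !rmorphM. Qed.

Lemma det_embed p q r : det (embed p) (embed q) (embed r) = ZtoR (detZ p q r).
Proof. by rewrite /detZ !(ZtoRB, ZtoRM). Qed.

Lemma complete_thickness_upper : geom_drawable R (complete_graph 15) 4.
Proof.
pose pos (u : 'I_15) := embed (ring_pt u).
pose layer (u v : 'I_15) : 'I_4 := inord (ring_layer u v).
exists pos, layer; apply: drawing_criterion.
- by move=> u v; rewrite /layer /ring_layer eq_sym addnC minnC.
- have mem (i : 'I_15) : (i : nat) \in iota 0%N 15%N by rewrite mem_iota ltn_ord.
  move=> u v w U; rewrite det_embed ZtoR_eq0.
  move/allP: ring_general_position => /(_ u (mem u))/allP/(_ v (mem v))/allP/(_ w (mem w)).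
  by rewrite -[uniq _]/(uniq [seq val i | i <- [:: u; v; w]]) (map_inj_uniq val_inj) U.
- have mem (i : 'I_15) : (i : nat) \in iota 0%N 15%N by rewrite mem_iota ltn_ord.
  move=> u v x y U /(congr1 val) /=.
  have lt4 a b : (ring_layer a b < 4)%N.
    rewrite /ring_layer; case: ifP => _; last by rewrite ltn_mod.
    by have := ltn_pmod (a + b) (isT : 0 < 8)%N; lia.
  rewrite !inordK // => E; rewrite !det_embed -!ZtoRM !ZtoR_gt0; apply/orP.
  move/allP: ring_layers_plane => /(_ u (mem u))/allP/(_ v (mem v))/allP/(_ x (mem x))/allP/(_ y (mem y)).
  rewrite -[uniq _]/(uniq [seq val i | i <- [:: u; v; x; y]]) (map_inj_uniq val_inj) U.
  by rewrite E eqxx.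
- move=> u v [] /intr_inj/(can_inj int_of_ZK) E1 /intr_inj/(can_inj int_of_ZK) E2.
  apply/val_inj/eqP; rewrite -(@nth_uniq _ (Z0, Z0) rings) //=.
  by rewrite -/(ring_pt _) [ring_pt u]surjective_pairing E1 E2 -surjective_pairing.
Qed.

End Embedding.

(* The geometric thickness of K_15 (drawn in the real plane R^2) is 4. *)
Theorem theorem4p1 :
  geometric_thickness_eq Rdefinitions.R (complete_graph 15) 4.
Proof.
split; first exact: complete_thickness_upper.
exact: complete_thickness_lower.
Qed.
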